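(* Let $U,V,W\subset\mathbb{C}$ be non-empty and compact, let $p\in[1,\infty]$, and put $\delta:=\min_{v\in V}|v|-\big(\max_{u\in U}|u|+\max_{w\in W}|w|\big)$. For $A\in M(U,V,W)$ consider the following statements: (i) $A$ is a Fredholm operator; (ii) $A$ is invertible; (iii) the full finite section method is applicable to $A$; (iv) all operators in $M(U,V,W)$, $M_+(U,V,W)$ and $M_{\mathrm{fin}}(U,V,W)$ are invertible and their inverses are uniformly bounded (in norm) from above; (v) the full finite section method is applicable to all operators in $M(U,V,W)$; (vi) all $B\in M(U,V,W)$ are invertible; (vii) all $B\in M(U,V,W)$ are Fredholm operators. Then: (a) For every $A\in M(U,V,W)$ the following implications hold: (iv)$\Rightarrow$(iii)$\Rightarrow$(ii)$\Rightarrow$(i); (iv)$\Rightarrow$(v)$\Rightarrow$(vi)$\Rightarrow$(vii); (v)$\Rightarrow$(iii); (vi)$\Rightarrow$(ii); (vii)$\Rightarrow$(i). (b) If $A\in\Psi E(U,V,W)$, then (i), (ii), (vi) and (vii) are equivalent, and (iii)$\Leftrightarrow$(v) holds. (c) If $A\in\Psi E(U,V,W)$, $0\in U$ and $0\in W$, then (i)–(vii) are all equivalent. (d) If $\delta>0$, then (i)–(vii) hold, and the norms of all the inverses are bounded above by $1/\delta$.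
   Context: $\mathbb{N}=\{1,2,3,\dots\}$. Matrices. $M(U,V,W)$ is the set of all bi-infinite tridiagonal matrices $A=(a_{ij})_{i,j\in\mathbb{Z}}$ with $a_{i,i-1}=u_i\in U$, $a_{ii}=v_i\in V$, $a_{i,i+1}=w_i\in W$ for all $i\in\mathbb{Z}$ and all other entries zero. $M_+(U,V,W)$ is the set of all semi-infinite tridiagonal matrices indexed by $\mathbb{N}\times\mathbb{N}$ with subdiagonal entries in $U$, main diagonal entries in $V$, superdiagonal entries in $W$ (all other entries zero). $M_n(U,V,W)$ is the set of $n\times n$ matrices of the same type, and $M_{\mathrm{fin}}(U,V,W)=\bigcup_{n\in\mathbb{N}}M_n(U,V,W)$. Matrices are identified with the bounded linear operators they induce by matrix-vector multiplication on $\ell^p(\mathbb{Z})$, $\ell^p(\mathbb{N})$ and $\mathbb{C}^n$ with the $p$-norm, respectively; norms of operators are the induced operator norms. An operator is Fredholm if its kernel is finite-dimensional and its image has finite codimension. Pseudoergodicity. $A\in\Psi E(U,V,W)$ means that $A\in M(U,V,W)$ and the sequence $(a_i)_{i\in\mathbb{Z}}$ with $a_i:=(u_i,v_i,w_i)\in\mathcal{M}:=U\times V\times W\subset\mathbb{C}^3$ is pseudoergodic, i.e. for every $\varepsilon>0$, every $n\in\mathbb{N}$ and every $(b_1,\dots,b_n)\in\mathcal{M}^n$ there is $k\in\mathbb{Z}$ with $|a_{k+i}-b_i|<\varepsilon$ for $i=1,\dots,n$. Finite section method (FSM). Let $X=\ell^p(\mathbb{Z})$. For integers $l\le r$ let $P_{l,r}:X\to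 X$ be the operator of multiplication by the characteristic function of $\{l,\dots,r\}$, with image $X_{l,r}\cong\mathbb{C}^{r-l+1}$. Given integer sequences $l_n\to-\infty$ and $r_n\to+\infty$ with $l_n\le r_n$, the FSM with cut-offs at $(l_n)$ and $(r_n)$ is applicable to a bounded operator $A$ on $X$ if $A$ is invertible and for every $b\in X$ the finite systems $P_{l_n,r_n}AP_{l_n,r_n}x_n=P_{l_n,r_n}b$ have a unique solution $x_n\in X_{l_n,r_n}$ for all sufficiently large $n$, and these solutions remain bounded in $n$ and converge componentwise to the solution $x$ of $Ax=b$. For band matrices it is known that this is equivalent to: $A$ is invertible and there is $n_0$ such that $P_{l_n,r_n}AP_{l_n,r_n}:X_{l_n,r_n}\to X_{l_n,r_n}$ is invertible for all $n\ge n_0$ with $\sup_{n\ge n_0}\|(P_{l_n,r_n}AP_{l_n,r_n})^{-1}\|<\infty$. The full FSM is the case $l_n=-n$, $r_n=n$. *)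

(* Defs.v *)
From mathcomp Require Import all_boot all_order all_algebra.
From mathcomp Require Import all_classical all_reals all_analysis.
From mathcomp.real_closed Require Export complex.

Set Implicit Arguments.
Unset Strict Implicit.
Unset Printing Implicit Defensive.

Import Order.TTheory GRing.Theory Num.Theory.
Import numFieldNormedType.Exports.

Local Open Scope classical_set_scope.
Local Open Scope ring_scope.
Local Open Scope complex_scope.

Notation cabs := ComplexField.Normc.normc.

Section Operators.
Variables (R : realType) (I : choiceType) (p : \bar R).
Implicit Types (x y : I -> R[i]) (T S : (I -> R[i]) -> (I -> R[i])).

(* The value at [p = -oo] is junk; only [1 <= p] is ever used. *)
Definition lpnorm x : \bar R :=
  match p with
  | q%:E => ((\esum_(i in [set: I]) (cabs (x i) `^ q)%:E) `^ q^-1)%E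
  | +oo%E => ereal_sup [set (cabs (x i))%:E | i in [set: I]]
  | -oo%E => 0%E
  end.

Definition lp : set (I -> R[i]) := [set x | (lpnorm x < +oo)%E].

(* An operator on [lp] is a function on all families whose values outside
   [lp] are irrelevant. *)
Definition bounded_operator T : Prop :=
  (forall (a : R[i]) x y, lp x -> lp y ->
     T (fun i => a * x i + y i) = (fun i => a * T x i + T y i)) /\
  (exists c : R, forall x, lp x -> (lpnorm (T x) <= c%:E * lpnorm x)%E).

Definition opnorm T : \bar R :=
  ereal_sup [set lpnorm (T x) | x in [set x | (lpnorm x <= 1)%E]].

Definition is_inverse T S : Prop :=
  [/\ bounded_operator T, bounded_operator S,
      forall x, lp x -> S (T x) = x & forall x, lp x -> T (S x) = x].

Definition invertible T : Prop := exists S, is_inverse T S.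

Definition invertible_le (c : R) T : Prop :=
  exists2 S, is_inverse T S & (opnorm S <= c%:E)%E.

(* The kernel lies in the span of finitely many vectors, and [lp] is the sum of
   the image and the span of finitely many vectors. *)
Definition fredholm T : Prop :=
  [/\ bounded_operator T,
      exists (n : nat) (e : 'I_n -> I -> R[i]),
        forall x, lp x -> T x = (fun=> 0) ->
        exists c : 'I_n -> R[i], x = (fun i => \sum_(k < n) c k * e k i)
    & exists (n : nat) (e : 'I_n -> I -> R[i]),
        (forall k, lp (e k)) /\
        forall y, lp y -> exists x (c : 'I_n -> R[i]),
          lp x /\ y = (fun i => T x i + \sum_(k < n) c k * e k i)].

End Operators.

Section Matrices.
Variable R : realType.

(* [\sum_(j \in _)] is the sum over the support of the summand, here finite
   because the rows of the matrices considered have at most three nonzero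
   entries. *)
Definition matop (I : choiceType) (A : I -> I -> R[i]) (x : I -> R[i])
    : I -> R[i] :=
  fun i => \sum_(j \in [set: I]) A i j * x j.

(* [pos i] is the integer position of the index [i]. *)
Definition tridiagonal (I : Type) (pos : I -> int) (U V W : set R[i])
    (A : I -> I -> R[i]) : Prop :=
  [/\ forall i j, pos i = pos j + 1 -> U (A i j),
      forall i, V (A i i),
      forall i j, pos j = pos i + 1 -> W (A i j)
    & forall i j, 1 < `|pos i - pos j| -> A i j = 0].

Definition Mbi (U V W : set R[i]) : set (int -> int -> R[i]) :=
  [set A | tridiagonal id U V W A].

(* The semi-infinite matrices are indexed from 0 instead of 1. *)
Definition Mplus (U V W : set R[i]) : set (nat -> nat -> R[i]) :=
  [set A | tridiagonal Posz U V W A].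

Definition Mn (n : nat) (U V W : set R[i]) : set 'M[R[i]]_n :=
  [set A | tridiagonal (fun i : 'I_n => Posz i) U V W A].

Definition norm3 (z : R[i] * R[i] * R[i]) : R :=
  Num.sqrt (cabs z.1.1 ^+ 2 + cabs z.1.2 ^+ 2 + cabs z.2 ^+ 2).

Definition pseudoergodic (M : set (R[i] * R[i] * R[i]))
    (a : int -> R[i] * R[i] * R[i]) : Prop :=
  forall e : R, 0 < e ->
  forall (n : nat) (b : 'I_n -> R[i] * R[i] * R[i]), (forall i, M (b i)) ->
  exists k : int, forall i : 'I_n, norm3 (a (k + i.+1%:Z) - b i) < e.

Definition PsiE (U V W : set R[i]) : set (int -> int -> R[i]) :=
  [set A | Mbi U V W A /\
     pseudoergodic (U `*` V `*` W)
       (fun i => (A i (i - 1), A i i, A i (i + 1)))].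

(* All members of the three classes are invertible on the l^p spaces, with
   inverses of norm at most [c]. *)
Definition all_invertible_le (p : \bar R) (U V W : set R[i]) (c : R) : Prop :=
  [/\ forall B, Mbi U V W B -> invertible_le p c (matop B),
      forall B, Mplus U V W B -> invertible_le p c (matop B)
    & forall (n : nat) (B : 'M[R[i]]_n), (0 < n)%N -> Mn U V W B ->
        invertible_le p c (matop B)].

End Matrices.

Section FiniteSections.
Variables (R : realType) (p : \bar R).
Implicit Types (x b : int -> R[i]) (T : (int -> R[i]) -> (int -> R[i])).

Definition Pcut (l r : int) x : int -> R[i] :=
  fun i => if l <= i <= r then x i else 0.

Definition Xcut (l r : int) : set (int -> R[i]) := range (Pcut l r).

(* The cut-offs are meant to satisfy [l n <= r n], [l n --> -oo] and
   [r n --> +oo]. *)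
Definition fsm_applicable (l r : nat -> int) T : Prop :=
  invertible p T /\
  forall b, lp p b ->
  exists (n0 : nat) (xs : nat -> int -> R[i]),
    [/\ forall n, (n0 <= n)%N ->
          [/\ Xcut (l n) (r n) (xs n),
              Pcut (l n) (r n) (T (Pcut (l n) (r n) (xs n)))
                = Pcut (l n) (r n) b
            & forall z, Xcut (l n) (r n) z ->
                Pcut (l n) (r n) (T (Pcut (l n) (r n) z))
                  = Pcut (l n) (r n) b -> z = xs n],
        exists c : R, forall n, (n0 <= n)%N -> (lpnorm p (xs n) <= c%:E)%E
      & forall x, lp p x -> T x = b ->
          forall i, (fun n => xs n i : R[i]^o) @ \oo --> (x i : R[i]^o)].

Definition full_fsm_applicable T : Prop :=
  fsm_applicable (fun n => - n%:Z) (fun n => n%:Z) T.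

End FiniteSections.

(* Main.v *)
(* Two facts hold for every p in [1, oo]: a bounded sequence in l^p has componentwise
   limits (along an ultrafilter) whose norm obeys the same bound, and tridiagonal
   operators are componentwise continuous and almost commute with slowly varying
   cut-offs.  Hence, if compressions of matrices B_n to index sets S_n have inverses
   of norm at most K and converge entrywise to the compression of B to S, then the
   latter also has an inverse of norm at most K.  For pseudoergodic A, every B in
   M(U,V,W) is such a limit of shifts of A, so (ii) => (vi).

   (i) => (ii): by Baire's theorem A is onto modulo a space of dimension n, with
   bounds.  A right-hand side, or a cut-off kernel vector, is copied into n + 1 far
   apart windows on which A almost repeats itself; linear dependence then shows that
   A is onto and injective.

   (iii) => (v): by Baire's theorem the finite sections of A are stable.  On the
   right or on the left, all B in M(U,V,W) recur in A, so that their half line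
   compressions ending on that side are invertible with a common bound.  The entries
   of these inverses decay exponentially, which bounds the transposed compressions
   below; transposing and reflecting exchanges the two kinds of half lines.  A vector
   on a long interval splits by a slowly varying partition of unity into two pieces
   that each see only one end, so long finite sections of every B are stable.

   If 0 lies in U and W, compressions are direct summands of elements of M(U,V,W),
   which gives (iv).  If delta > 0, diagonal dominance bounds all compressions below;
   finite ones are then onto by dimension, infinite ones as limits of finite ones. *)

Require Import Defs.
From mathcomp Require Import all_boot all_order all_algebra.
From mathcomp Require Import all_classical all_reals all_analysis.
From mathcomp Require Import zify ring lra.

Set Implicit Arguments.
Unset Strict Implicit.
Unset Printing Implicit Defensive.

Import Order.TTheory GRing.Theory Num.Theory.
Import numFieldNormedType.Exports.
Import ComplexField.Normc.

Local Open Scope classical_set_scope.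
Local Open Scope ring_scope.

(** * The norm of l^p *)

Section ComplexAbs.
Variable R : realType.
Implicit Types x y z : complex R.

Lemma cabs_ge0 z : 0 <= cabs z.
Proof. by case: z => a b; exact: sqrtr_ge0. Qed.

Lemma cabsB x y : cabs (x - y) = cabs (y - x).
Proof. by rewrite -normcN opprB. Qed.

Lemma cabs_eq0 z : (cabs z == 0) = (z == 0).
Proof. by apply/eqP/eqP => [/eq0_normc//|->]; rewrite normc0. Qed.

Lemma cabs_real (t : R) : cabs (real_complex R t) = `|t|.
Proof. by rewrite /= expr0n addr0 sqrtr_sqr. Qed.

Lemma cabs_sum (I : Type) (s : seq I) (P : pred I) (f : I -> complex R) :
  cabs (\sum_(i <- s | P i) f i) <= \sum_(i <- s | P i) cabs (f i).
Proof.
elim/big_rec2 : _ => [|i t z _ le]; first by rewrite normc0.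
by rewrite (le_trans (le_normcD _ _))// lerD2l.
Qed.

Lemma cabs_Re z : `|complex.Re z| <= cabs z.
Proof. by case: z => a b /=; rewrite -sqrtr_sqr ler_wsqrtr// lerDl sqr_ge0. Qed.

Lemma cabs_Im z : `|complex.Im z| <= cabs z.
Proof. by case: z => a b /=; rewrite -sqrtr_sqr ler_wsqrtr// lerDr sqr_ge0. Qed.

Lemma cabs_ReIm z : cabs z <= `|complex.Re z| + `|complex.Im z|.
Proof.
case: z => a b /=; rewrite -[leRHS]ger0_norm ?addr_ge0// -[leRHS]sqrtr_sqr.
apply: ler_wsqrtr; rewrite sqrrD !real_normK ?num_real//.
by rewrite addrAC lerDl mulrn_wge0 ?mulr_ge0.
Qed.

Lemma cabs_dist x y : `|cabs x - cabs y| <= cabs (x - y).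
Proof.
have h u v : cabs u - cabs v <= cabs (u - v).
  by rewrite lerBlDr -{1}(subrK v u) le_normcD.
by rewrite ler_norml h andbT lerNl opprB cabsB h.
Qed.

End ComplexAbs.

Section LpNorm.
Variables (R : realType).
Implicit Types (I J : choiceType) (p : \bar R) (q c : R).

(** The extended sum is a supremum over finite sets, so for finite p every norm estimate reduces to
    finite sums of real numbers. The sign of [c] is recorded separately, since a power of a negative
    base is a junk value. *)
Lemma lpnorm_fin_le I q (x : I -> complex R) c : 1 <= q ->
  (lpnorm q%:E x <= c%:E)%E <->
  0 <= c /\ forall s : seq I, uniq s -> \sum_(i <- s) cabs (x i) `^ q <= c `^ q.
Proof.
move=> q1; have q0 : 0 < q by lra.
have qn0 : q != 0 by rewrite gt_eqF.
split.
- rewrite /lpnorm; set E := esum _ _ => h.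
  have E0 : (0 <= E)%E by apply: esum_ge0 => i _; rewrite lee_fin powR_ge0.
  have c0 : 0 <= c by rewrite -lee_fin (le_trans _ h)// poweR_ge0.
  split=> // s us.
  have Ec : (E <= (c `^ q)%:E)%E.
    move: E0 h; case: (E) => [e|//|//]; last by rewrite poweRyr ?invr_eq0.
    rewrite poweR_EFin !lee_fin => e0 h.
    rewrite -[e](powRr1 e0) -(mulVf qn0) powRrM.
    by rewrite ge0_ler_powR ?nnegrE ?powR_ge0// ltW.
  rewrite -lee_fin (le_trans _ Ec)// -sumEFin fsbig_seq//.
  by apply: ereal_sup_ubound; exists [set` s] => //; split.
- move=> [c0 h]; rewrite /lpnorm; set E := esum _ _.
  have E0 : (0 <= E)%E by apply: esum_ge0 => i _; rewrite lee_fin powR_ge0.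
  have Ec : (E <= (c `^ q)%:E)%E.
    apply: ge_ereal_sup => _ [A [finA _] <-].
    by rewrite fsbig_finite//= sumEFin lee_fin h.
  move: E0 Ec; case: (E) => [e|//|//]; rewrite poweR_EFin !lee_fin => e0 ec.
  rewrite -[c](powRr1 c0) -(mulfV qn0) powRrM.
  by rewrite ge0_ler_powR ?nnegrE ?powR_ge0// invr_ge0 ltW.
Qed.

Lemma lpnorm_inf_le I (i0 : I) (x : I -> complex R) c :
  (lpnorm +oo%E x <= c%:E)%E <-> forall i, cabs (x i) <= c.
Proof.
split=> [h i|h].
  by rewrite -lee_fin (le_trans _ h)//; apply: ereal_sup_ubound; exists i.
by apply: ge_ereal_sup => _ [i _ <-]; rewrite lee_fin.
Qed.

(** Convexity of the q-th power at u / a and v / b, with weights proportional to a and b. This is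
    the pointwise form of Minkowski's inequality. *)
Lemma powR_convexD q (a b u v : R) : 1 <= q -> 0 < a -> 0 < b ->
  0 <= u -> 0 <= v ->
  ((u + v) / (a + b)) `^ q <=
    a / (a + b) * (u / a) `^ q + b / (a + b) * (v / b) `^ q.
Proof.
move=> q1 a0 b0 u0 v0; have ab0 : 0 < a + b by lra.
have t01 : 0 <= a / (a + b) <= 1.
  apply/andP; split; first by rewrite divr_ge0// ltW.
  by rewrite ler_pdivrMr// mul1r; lra.
have/andP[t0 t1] := t01.
have := @convex_powR R q q1 (Itv01 t0 t1) (u / a) (v / b).
rewrite !inE/= !in_itv/= !andbT => /(_ _ _)/=.
rewrite [conv _ _ _]convRE !convRE/= /unstable.onem => h.
have -> : (u + v) / (a + b) = a / (a + b) * (u / a) + (1 - a / (a + b)) * (v / b).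
  by field; rewrite !gt_eqF.
have -> : b / (a + b) = 1 - a / (a + b) by field; rewrite gt_eqF.
by apply: h; rewrite divr_ge0// ltW.
Qed.

(** After normalization by a and b the convexity inequality is summed, and its weights add up to 1.
    A bound equal to 0 cannot be divided by, but then the family vanishes on [s]. *)
Lemma minkowski_seq I q (s : seq I) (x y : I -> complex R) (a b : R) :
  1 <= q -> 0 <= a -> 0 <= b ->
  (\sum_(i <- s) cabs (x i) `^ q <= a `^ q) ->
  (\sum_(i <- s) cabs (y i) `^ q <= b `^ q) ->
  \sum_(i <- s) cabs (x i + y i) `^ q <= (a + b) `^ q.
Proof.
move=> q1; have q0 : 0 < q by lra.
have z0 (z : I -> complex R) : \sum_(i <- s) cabs (z i) `^ q <= 0 `^ q ->
    forall i, i \in s -> z i = 0.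
  rewrite powR0 ?gt_eqF// => h i si; apply/eqP; rewrite -cabs_eq0.
  have : \sum_(i <- s) cabs (z i) `^ q == 0.
    by rewrite eq_le h sumr_ge0// => j _; rewrite powR_ge0.
  rewrite psumr_eq0; last by move=> j _; rewrite powR_ge0.
  by move=> /allP/(_ i si)/=/eqP/powR_eq0_eq0 ->.
rewrite le_eqVlt => /predU1P[<- b0 /z0 hx hy|a0].
  rewrite add0r (le_trans _ hy)// le_eqVlt; apply/orP; left; apply/eqP.
  by apply: eq_big_seq => i si; rewrite hx// add0r.
rewrite le_eqVlt => /predU1P[<- hx /z0 hy|b0].
  rewrite addr0 (le_trans _ hx)// le_eqVlt; apply/orP; left; apply/eqP.
  by apply: eq_big_seq => i si; rewrite hy// addr0.
move=> hx hy; have ab0 : 0 < a + b by lra.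
have scale (c : R) u : 0 < c -> 0 <= u -> (u / c) `^ q = u `^ q / c `^ q.
  move=> c0 u0; have ci : 0 <= c^-1 by rewrite invr_ge0 ltW.
  by rewrite powRM// -(powR_inv1 (ltW c0)) -!powRrM mulN1r powRN.
have step i : cabs (x i + y i) `^ q <= (a + b) `^ q * (a / (a + b) *
    (cabs (x i) `^ q / a `^ q) + b / (a + b) * (cabs (y i) `^ q / b `^ q)).
  rewrite -!scale ?cabs_ge0//.
  have := powR_convexD q1 a0 b0 (cabs_ge0 (x i)) (cabs_ge0 (y i)).
  rewrite (scale _ _ ab0 (addr_ge0 (cabs_ge0 (x i)) (cabs_ge0 (y i)))).
  rewrite ler_pdivrMr ?powR_gt0// [X in _ <= X]mulrC.
  apply: le_trans; apply: ge0_ler_powR; rewrite ?nnegrE ?addr_ge0 ?cabs_ge0//; first lra.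
  exact: le_normcD.
apply: (le_trans (ler_sum _ (fun i _ => step i))).
rewrite -mulr_sumr -[leRHS]mulr1 ler_wpM2l ?powR_ge0//.
rewrite big_split/= -!mulr_sumr -!mulr_suml.
have -> : 1 = a / (a + b) * 1 + b / (a + b) * 1 by field; rewrite gt_eqF.
have ab1 : 0 <= (a + b)^-1 by rewrite invr_ge0 ltW.
by rewrite lerD// ler_wpM2l ?mulr_ge0 ?(ltW a0) ?(ltW b0)// ler_pdivrMr ?powR_gt0// mul1r.
Qed.

Variable p : \bar R.
Hypothesis p1 : (1 <= p)%E.

(** The index [i0] excludes the supremum of the empty set, which is -oo. *)
Lemma lpnorm_ge0 I (i0 : I) (x : I -> complex R) : (0 <= lpnorm p x)%E.
Proof.
move: p1; case: p => [q|//|//] _ /=; first exact: poweR_ge0.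
by apply: ereal_sup_ge; exists (cabs (x i0))%:E; [exists i0|rewrite lee_fin cabs_ge0].
Qed.

Lemma lpnorm_leD I (i0 : I) (x y : I -> complex R) a b :
  (lpnorm p x <= a%:E)%E -> (lpnorm p y <= b%:E)%E ->
  (lpnorm p (fun i => (x i + y i)%R) <= (a + b)%:E)%E.
Proof.
move: p1; case: p => [q|//|//].
  rewrite lee_fin => q1 /(lpnorm_fin_le _ _ q1)[a0 ha] /(lpnorm_fin_le _ _ q1)[b0 hb].
  apply/(lpnorm_fin_le _ _ q1); split; first by rewrite addr_ge0.
  by move=> s us; apply: minkowski_seq => //; [exact: ha|exact: hb].
move=> _ /(lpnorm_inf_le i0) ha /(lpnorm_inf_le i0) hb; apply/(lpnorm_inf_le i0) => i.
by rewrite (le_trans (le_normcD _ _))// lerD.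
Qed.

(** The common source of monotonicity, restriction, shifts and the passage between index sets: [g]
    is injective on the support of x, so the sum for x is dominated by a partial sum for y. *)
Lemma lpnorm_le_reindex I (J : choiceType) (i0 : I) (g : I -> J) (x : I -> complex R)
    (y : J -> complex R) t c : 0 <= t ->
  (forall i j, x i != 0 -> x j != 0 -> g i = g j -> i = j) ->
  (forall i, x i != 0 -> cabs (x i) <= t * cabs (y (g i))) ->
  (lpnorm p y <= c%:E)%E -> (lpnorm p x <= (t * c)%:E)%E.
Proof.
move=> t0 gI xy; move: p1; case: p => [q|//|//].
  rewrite lee_fin => q1 /(lpnorm_fin_le _ _ q1)[c0 h].
  have q0 : 0 < q by lra.
  apply/(lpnorm_fin_le _ _ q1); split=> [|s us]; first by rewrite mulr_ge0.
  rewrite powRM// (bigID (fun i => x i == 0))/= big1 ?add0r; last first.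
    by move=> i /eqP ->; rewrite normc0 powR0 ?gt_eqF.
  have us' : uniq [seq g i | i <- s & x i != 0].
    rewrite map_inj_in_uniq ?filter_uniq// => i j.
    by rewrite !mem_filter => /andP[xi _] /andP[xj _]; exact: gI.
  apply: (le_trans _ (ler_wpM2l (powR_ge0 _ _) (h _ us'))).
  rewrite big_map big_filter mulr_sumr; apply: ler_sum => i xi.
  by rewrite -powRM ?cabs_ge0// ge0_ler_powR ?nnegrE ?mulr_ge0 ?cabs_ge0 ?xy// ltW.
move=> _ /(lpnorm_inf_le (g i0)) h; apply/(lpnorm_inf_le i0) => i.
have [->|xi] := eqVneq (x i) 0.
  by rewrite normc0 mulr_ge0// (le_trans _ (h (g i0)))// cabs_ge0.
by rewrite (le_trans (xy _ xi))// ler_wpM2l.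
Qed.

Lemma le_cabs_lpnorm I (x : I -> complex R) c i :
  (lpnorm p x <= c%:E)%E -> cabs (x i) <= c.
Proof.
move: p1; case: p => [q|//|//]; last by move=> _ /(lpnorm_inf_le i) ->.
rewrite lee_fin => q1 /(lpnorm_fin_le _ _ q1)[c0 /(_ [:: i] isT)].
rewrite big_seq1 => h; have q0 : 0 < q by lra.
rewrite leNgt; apply/negP => ic; have := gt0_ltr_powR q0 _ _ ic.
by rewrite !nnegrE c0 cabs_ge0 ltNge h => /(_ isT isT).
Qed.

Lemma lpnorm_delta_le I (i : I) (z : complex R) :
  (lpnorm p (fun j => if j == i then z else 0%R) <= (cabs z)%:E)%E.
Proof.
move: p1; case: p => [q|//|//]; last first.
  move=> _; apply/(lpnorm_inf_le i) => j; case: ifP => // _.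
  by rewrite normc0 cabs_ge0.
rewrite lee_fin => q1; have q0 : 0 < q by lra.
apply/(lpnorm_fin_le _ _ q1); split=> [|s us]; first exact: cabs_ge0.
rewrite (bigID (pred1 i))/= [X in _ + X]big1 ?addr0; last first.
  by move=> j /negbTE ->; rewrite normc0 powR0 ?gt_eqF.
rewrite (eq_bigr (fun=> cabs z `^ q)); last by move=> j ->.
rewrite big_const_seq iter_addr_0 count_uniq_mem//.
by case: (_ \in _); rewrite ?mulr1n// mulr0n powR_ge0.
Qed.

End LpNorm.

(** * Componentwise limits *)

Lemma exists_ultra_nat : exists U : set_system nat,
  UltraFilter U /\ (forall A, (\oo : set_system nat) A -> U A).
Proof. exact: ultraFilterLemma. Qed.

(* A single nonprincipal ultrafilter makes all components of a bounded sequence of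
   families converge simultaneously. *)
Definition ultra_nat : set_system nat := projT1 (cid exists_ultra_nat).

Lemma ultra_natP : UltraFilter ultra_nat.
Proof. by rewrite /ultra_nat; case: cid => U [] /=. Qed.
#[local] Existing Instance ultra_natP.

Lemma ultra_nat_ge (P : nat -> Prop) N :
  (forall n, (N <= n)%N -> P n) -> ultra_nat [set n | P n].
Proof.
move=> h; rewrite /ultra_nat; case: cid => U [/= _]; apply.
by exists N => // n /= Nn; exact: h.
Qed.

Section UltraLimits.
Variable R : realType.
Implicit Types (z w : nat -> complex R) (l m : complex R).

Definition tends z l :=
  forall e : R, 0 < e -> ultra_nat [set n | cabs (z n - l) < e].

Lemma tends_uniq z l m : tends z l -> tends z m -> l = m.
Proof.
move=> zl zm; apply/eqP; rewrite -subr_eq0 -cabs_eq0 eq_le cabs_ge0 andbT.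
apply/ler_addgt0Pr => e e0; rewrite add0r; have e2 : 0 < e / 2 by lra.
have [n [/= h1 h2]] := filter_ex (filterI (zl _ e2) (zm _ e2)).
have -> : l - m = (z n - m) - (z n - l) by ring.
by rewrite (le_trans (le_normcD _ _))// normcN; lra.
Qed.

Lemma tends_near z w l : ultra_nat [set n | z n = w n] -> tends w l -> tends z l.
Proof.
move=> zw wl e e0; apply: filterS (filterI zw (wl _ e0)) => n /= [-> //].
Qed.

Lemma tends_cst l : tends (fun=> l) l.
Proof. by move=> e e0; apply: filterE => n; rewrite /= subrr normc0. Qed.

Lemma tendsD z w l m : tends z l -> tends w m -> tends (fun n => z n + w n) (l + m).
Proof.
move=> zl wm e e0; have e2 : 0 < e / 2 by lra.
apply: filterS (filterI (zl _ e2) (wm _ e2)) => n /= [h1 h2].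
have -> : z n + w n - (l + m) = (z n - l) + (w n - m) by ring.
by rewrite (le_lt_trans (le_normcD _ _))//; lra.
Qed.

Lemma tendsM z w l m : tends z l -> tends w m -> tends (fun n => z n * w n) (l * m).
Proof.
move=> zl wm e e0.
(* If both errors are below f <= 1, the expanded product error is below f (1 + |l| + |m|) = f d <=
   e. *)
set d := cabs l + cabs m + 1.
have [l0 m0] := (cabs_ge0 l, cabs_ge0 m).
have d0 : 0 < d by rewrite /d; lra.
pose f := Num.min 1 (e / d).
have f0 : 0 < f by rewrite /f lt_min ltr01 divr_gt0.
apply: filterS (filterI (zl _ f0) (wm _ f0)) => n /= [h1 h2].
have -> : z n * w n - l * m = (z n - l) * (w n - m) + (z n - l) * m + l * (w n - m).
  by ring.
have fd : f * d <= e by rewrite -ler_pdivlMr// ge_min lexx orbT.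
have f1 : f <= 1 by rewrite ge_min lexx.
have [a0 b0] := (cabs_ge0 (z n - l), cabs_ge0 (w n - m)).
rewrite (le_lt_trans (le_normcD _ _))// (le_lt_trans (lerD (le_normcD _ _) (lexx _)))//.
rewrite !normcM; move: fd; rewrite /d; nra.
Qed.

Lemma tends_sum (J : Type) (s : seq J) (f : J -> nat -> complex R) (l : J -> complex R) :
  (forall j, tends (f j) (l j)) ->
  tends (fun n => \sum_(j <- s) f j n) (\sum_(j <- s) l j).
Proof.
move=> h; elim: s => [|j s ih].
  rewrite big_nil (_ : (fun n => _) = fun=> 0); first exact: tends_cst.
  by apply/funext => n; rewrite big_nil.
rewrite big_cons (_ : (fun n => _) = fun n => f j n + \sum_(j <- s) f j n).
  exact: tendsD.
by apply/funext => n; rewrite big_cons.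
Qed.

Lemma tends_cabs_le z l c : tends z l -> ultra_nat [set n | cabs (z n) <= c] ->
  cabs l <= c.
Proof.
move=> zl zc; apply/ler_addgt0Pr => e e0.
have [n [/= h1 h2]] := filter_ex (filterI (zl _ e0) zc).
have -> : l = z n - (z n - l) by ring.
by rewrite (le_trans (le_normcD _ _))// normcN; lra.
Qed.

(** The segment is compact, so the image of the ultrafilter has a cluster point; for an ultrafilter
    a cluster point is a limit, because otherwise the complement of some neighbourhood would belong
    to it. *)
Lemma tends_real (r : nat -> R) c : (forall n, `|r n| <= c) ->
  exists l : R, forall e, 0 < e -> ultra_nat [set n | `|r n - l| < e].
Proof.
move=> rc; have := @segment_compact R (- c) c.
have PF : ProperFilter (r @ ultra_nat) by exact: fmap_proper_filter.
move=> /(_ _ PF); case.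
  apply: (@filterE _ ultra_nat) => n; rewrite /preimage/= in_itv/= -ler_norml.
  exact: rc.
move=> l [_ cl]; exists l => e e0.
have [//|/= he] := in_ultra_setVsetC [set n | `|r n - l| < e] ultra_natP.
have := cl (r @` (~` [set n | `|r n - l| < e])) (ball l e).
case; [|exact: nbhsx_ballx|].
  by apply: filterS he => n hn; exists n.
by move=> _ [[n /= hn <-]]; rewrite /ball/= distrC.
Qed.

Lemma tends_bounded z c : (forall n, cabs (z n) <= c) -> exists l, tends z l.
Proof.
move=> zc.
have [a ha] := tends_real (fun n => le_trans (cabs_Re (z n)) (zc n)).
have [b hb] := tends_real (fun n => le_trans (cabs_Im (z n)) (zc n)).
exists (Complex a b) => e e0; have e2 : 0 < e / 2 by lra.
apply: filterS (filterI (ha _ e2) (hb _ e2)) => n /= [h1 h2].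
rewrite (le_lt_trans (cabs_ReIm _))//.
by move: h1 h2; case: (z n) => u v /=; lra.
Qed.

End UltraLimits.

(** * The norm on families indexed by the integers *)

Section IntNorm.
Variables (R : realType) (p : \bar R).
Hypothesis p1 : (1 <= p)%E.
Implicit Types (x y : int -> complex R).

(* Because of [fine], [nm x = 0] when [x] is not in [lp]. *)
Definition nm x : R := fine (lpnorm p x).

(** A bound on the extended norm carries membership in [lp] along with the real bound; the latter
    alone says nothing, because of the junk value of [nm]. *)
Lemma bdE x c : (lpnorm p x <= c%:E)%E <-> lp p x /\ nm x <= c.
Proof.
have x0 := lpnorm_ge0 p1 (0 : int) x.
rewrite /nm /lp/=; move: x0; case: (lpnorm p x) => [r|//|//] _ /=.
  by rewrite lee_fin ltry; split=> [|[]].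
by split=> [|[]].
Qed.

Lemma nm_bd x : lp p x -> (lpnorm p x <= (nm x)%:E)%E.
Proof. by move=> h; apply/bdE. Qed.

Lemma nm_ge0 x : 0 <= nm x.
Proof. by rewrite fine_ge0// (lpnorm_ge0 p1 (0 : int)). Qed.

Lemma nmD x y : lp p x -> lp p y ->
  lp p (fun i => x i + y i) /\ nm (fun i => x i + y i) <= nm x + nm y.
Proof. by move=> hx hy; apply/bdE; apply: (lpnorm_leD p1 0); exact: nm_bd. Qed.

Lemma nm_reindex (g : int -> int) x y t : 0 <= t ->
  (forall i j, x i != 0 -> x j != 0 -> g i = g j -> i = j) ->
  (forall i, x i != 0 -> cabs (x i) <= t * cabs (y (g i))) ->
  lp p y -> lp p x /\ nm x <= t * nm y.
Proof.
move=> t0 gi xy hy; apply/bdE.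
by apply: (lpnorm_le_reindex p1 0 t0 gi xy); exact: nm_bd.
Qed.

Lemma nm_mono x y t : 0 <= t -> (forall i, cabs (x i) <= t * cabs (y i)) ->
  lp p y -> lp p x /\ nm x <= t * nm y.
Proof. by move=> t0 xy; apply: (@nm_reindex id) => // i j. Qed.

Lemma nm_shift k x : lp p x -> lp p (fun i => x (i + k)) /\ nm (fun i => x (i + k)) <= nm x.
Proof.
move=> hx; have := @nm_reindex (fun i => i + k) (fun i => x (i + k)) x 1 ler01.
rewrite mul1r; apply=> // [i j _ _|i _]; first exact: addIr.
by rewrite mul1r.
Qed.

Lemma cabs_le_nm x i : lp p x -> cabs (x i) <= nm x.
Proof. by move=> /nm_bd; exact: le_cabs_lpnorm. Qed.

Lemma nm_eq0 x : lp p x -> nm x <= 0 -> x = (fun=> 0).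
Proof.
move=> hx x0; apply/funext => i; apply/eqP; rewrite -cabs_eq0 eq_le cabs_ge0 andbT.
exact: le_trans (cabs_le_nm i hx) x0.
Qed.

Lemma nm0 : lp p (fun _ : int => 0 : complex R) /\ nm (fun=> 0) = 0.
Proof.
have h : (lpnorm p (fun _ : int => 0%R : complex R) <= (cabs (0 : complex R))%:E)%E.
  apply: le_trans (lpnorm_delta_le p1 (0 : int) 0).
  rewrite le_eqVlt; apply/orP; left; apply/eqP; congr lpnorm.
  by apply/funext => j; case: ifP.
move: h; rewrite normc0 => /bdE[? ?]; split=> //; apply/eqP.
by rewrite eq_le nm_ge0 andbT.
Qed.

Lemma nmZ (a : complex R) x : lp p x ->
  lp p (fun i => a * x i) /\ nm (fun i => a * x i) <= cabs a * nm x.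
Proof. by move=> hx; apply: nm_mono => // [|i]; rewrite ?cabs_ge0// normcM. Qed.

Lemma nmN x : lp p x -> lp p (fun i => - x i) /\ nm (fun i => - x i) <= nm x.
Proof.
by move=> hx; rewrite -[leRHS]mul1r; apply: nm_mono => // i; rewrite normcN mul1r.
Qed.

Lemma nmB x y : lp p x -> lp p y ->
  lp p (fun i => x i - y i) /\ nm (fun i => x i - y i) <= nm x + nm y.
Proof.
move=> hx /nmN[hy hy']; have [h h'] := nmD hx hy; split=> //.
by rewrite (le_trans h')// lerD2l.
Qed.

Lemma nm_sum (J : eqType) (s : seq J) (f : J -> int -> complex R) (c : J -> R) :
  (forall j, j \in s -> lp p (f j) /\ nm (f j) <= c j) ->
  lp p (fun i => \sum_(j <- s) f j i) /\
  nm (fun i => \sum_(j <- s) f j i) <= \sum_(j <- s) c j.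
Proof.
elim: s => [_|j s ih h].
  have [h0 h1] := nm0; rewrite big_nil.
  rewrite (_ : (fun i => _) = (fun=> 0)); last by apply/funext => i; rewrite big_nil.
  by rewrite h1.
have [|h1 h2] := ih; first by move=> k ks; apply: h; rewrite inE ks orbT.
have [h3 h4] := h j (mem_head _ _).
rewrite (_ : (fun i => _) = (fun i => f j i + \sum_(j <- s) f j i)); last first.
  by apply/funext => i; rewrite big_cons.
have [h5 h6] := nmD h3 h1; split=> //.
by rewrite big_cons (le_trans h6)// lerD.
Qed.

Lemma nm_delta (i : int) (z : complex R) :
  lp p (fun j => if j == i then z else 0) /\
  nm (fun j => if j == i then z else 0) <= cabs z.
Proof. by apply/bdE; exact: lpnorm_delta_le. Qed.

Lemma nm_finsupp (s : seq int) x : uniq s ->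
  lp p (fun i => if i \in s then x i else 0) /\
  nm (fun i => if i \in s then x i else 0) <= \sum_(i <- s) cabs (x i).
Proof.
move=> us.
rewrite (_ : (fun i => _) = fun i => \sum_(j <- s) if i == j then x j else 0).
  by apply: nm_sum => j _; exact: nm_delta.
apply/funext => i; case: ifPn => si; last first.
  by rewrite big_seq big1// => j js; case: eqP => // ij; rewrite ij js in si.
rewrite (bigD1_seq i)//= eqxx big1 ?addr0// => j.
by rewrite eq_sym => /negbTE ->.
Qed.

Lemma nm_restrict (P : pred int) x : lp p x ->
  lp p (fun i => if P i then x i else 0) /\
  nm (fun i => if P i then x i else 0) <= nm x.
Proof.
move=> hx; rewrite -[nm x]mul1r; apply: nm_mono => // i; rewrite mul1r.
by case: ifP => //; rewrite normc0 cabs_ge0.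
Qed.

(** For finite p and for p = +oo alike, the norm is determined by finite truncations; membership in
    [lp] is therefore a conclusion. *)
Lemma nm_sup x c :
  (forall s : seq int, uniq s -> nm (fun i => if i \in s then x i else 0) <= c) ->
  lp p x /\ nm x <= c.
Proof.
move=> h; have {}h s : uniq s ->
    (lpnorm p (fun i => if i \in s then x i else 0%R) <= c%:E)%E.
  by move=> us; apply/bdE; split; [exact: (nm_finsupp x us).1|exact: h].
apply/bdE; move: p1 h; case: (p) => [q|//|//].
  rewrite lee_fin => q1 h; apply/(lpnorm_fin_le _ _ q1); split.
    by have /(lpnorm_fin_le _ _ q1)[] := h [::] isT.
  move=> s us; have /(lpnorm_fin_le _ _ q1)[_ /(_ s us)] := h s us.
  by apply: le_trans; rewrite le_eqVlt; apply/orP; left; apply/eqP/eq_big_seq => i ->.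
move=> _ h; apply/(lpnorm_inf_le (0 : int)) => i.
by have /(lpnorm_inf_le (0 : int))/(_ i) := h [:: i] isT; rewrite inE eqxx.
Qed.

(** Lower semicontinuity of the norm: on a finite set componentwise convergence is uniform, and
    finite sets suffice by [nm_sup]. *)
Lemma nm_fatou (x : nat -> int -> complex R) l c :
  (forall i, tends (x ^~ i) (l i)) -> (forall n, lp p (x n) /\ nm (x n) <= c) ->
  lp p l /\ nm l <= c.
Proof.
move=> xl xc; apply: nm_sup => s us; apply/ler_addgt0Pr => e e0.
(* One n serves all of [s]; the errors of the components then add up to at most e. *)
have [n hn] : exists n, forall i, i \in s -> cabs (x n i - l i) < e / (size s).+1%:R.
  have e1 : 0 < e / (size s).+1%:R by rewrite divr_gt0.
  move: e1; set d := e / _ => e1.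
  suff /filter_ex[n hn] : ultra_nat [set n | forall i, i \in s ->
      cabs (x n i - l i) < d] by exists n.
  elim: (s) => [|i t ih]; first by apply: filterE.
  apply: filterS (filterI (xl i _ e1) ih) => n /= [h1 h2] j.
  by rewrite inE => /orP[/eqP->//|/h2].
have [h1 h2] := nm_restrict (fun i => i \in s) (xc n).1.
have [h3 h4] := nm_finsupp (fun i => l i - x n i) us.
have [_ h5] := nmD h1 h3.
have -> : (fun i => if i \in s then l i else 0) = (fun i =>
    (if i \in s then x n i else 0) + (if i \in s then l i - x n i else 0)).
  by apply/funext => i; case: ifP => _; rewrite ?addr0// addrC subrK.
rewrite (le_trans h5)// lerD// ?(le_trans h2 (xc n).2)// (le_trans h4)//.
rewrite big_seq (le_trans (ler_sum _ (_ : forall i, i \in s -> _ <= e / (size s).+1%:R)))//.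
  by move=> i si; rewrite cabsB ltW// hn.
rewrite -big_seq big_const_seq count_predT iter_addr_0 -[_ *+ size s]mulr_natr mulrAC.
by rewrite ler_pdivrMr// ler_wpM2l ?(ltW e0)// ler_nat.
Qed.

(** Takes the place of weak-star compactness of closed balls, uniformly in p. *)
Lemma nm_compact (x : nat -> int -> complex R) c :
  (forall n, lp p (x n) /\ nm (x n) <= c) ->
  exists l, [/\ lp p l, nm l <= c & forall i, tends (x ^~ i) (l i)].
Proof.
move=> xc.
have /choice[l hl] : forall i, exists l, tends (x ^~ i) l.
  move=> i; apply: (@tends_bounded _ _ c) => n.
  exact: le_trans (cabs_le_nm i (xc n).1) (xc n).2.
by exists l; have [? ?] := nm_fatou hl xc.
Qed.

End IntNorm.

Lemma near_pred (i : int) : `|i - (i - 1)| <= 1. Proof. lia. Qed.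
Lemma near_self (i : int) : `|i - i| <= 1. Proof. lia. Qed.
Lemma near_succ (i : int) : `|i - (i + 1)| <= 1. Proof. lia. Qed.

(** * Compressions of tridiagonal operators and their limits *)

Section Tridiagonal.
Variables (R : realType).
Local Notation C := (complex R).
Implicit Types (x y : int -> C) (B : int -> int -> C) (S : pred int).

(** Reads only the three diagonals, which avoids the finitely supported sums of [matop]; the two
    agree on tridiagonal matrices. *)
Definition op B x : int -> C :=
  fun i => B i (i - 1) * x (i - 1) + B i i * x i + B i (i + 1) * x (i + 1).

(** Compressions stay on the whole of the integers, padded by zeros, so that those to different
    index sets act on one space and can be compared. *)
Definition sec S B : int -> int -> C :=
  fun i j => if S i && S j then B i j else 0.

Definition supp S x := forall i, ~~ S i -> x i = 0.

Definition bounded_by B (b : R) := forall i j, cabs (B i j) <= b.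

Lemma opZD B (a : C) x y :
  op B (fun i => a * x i + y i) = (fun i => a * op B x i + op B y i).
Proof. by apply/funext => i; rewrite /op; ring. Qed.

Lemma opB B x y : op B (fun i => x i - y i) = (fun i => op B x i - op B y i).
Proof. by apply/funext => i; rewrite /op; ring. Qed.

Lemma opZ B (a : C) x : op B (fun i => a * x i) = (fun i => a * op B x i).
Proof. by apply/funext => i; rewrite /op; ring. Qed.

Lemma op0 B : op B (fun=> 0) = (fun=> 0).
Proof. by apply/funext => i; rewrite /op; ring. Qed.

Lemma op_sum B (J : Type) (s : seq J) (a : J -> C) (f : J -> int -> C) :
  op B (fun i => \sum_(j <- s) a j * f j i) =
  (fun i => \sum_(j <- s) a j * op B (f j) i).
Proof.
elim: s => [|j s ih].
  rewrite (_ : (fun i => _) = (fun=> 0)) ?op0; apply/funext => i; by rewrite big_nil.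
rewrite (_ : (fun i => _) = (fun i => a j * f j i + \sum_(j <- s) a j * f j i)).
  by rewrite opZD ih; apply/funext => i; rewrite big_cons.
by apply/funext => i; rewrite big_cons.
Qed.

Lemma tends_op (Bn : nat -> int -> int -> C) B (xn : nat -> int -> C) x i :
  (forall j, tends (fun n => Bn n i j) (B i j)) ->
  (forall j, tends (xn ^~ j) (x j)) ->
  tends (fun n => op (Bn n) (xn n) i) (op B x i).
Proof.
move=> hB hx; have h j := tendsM (hB j) (hx j).
by apply: tendsD; [apply: tendsD|]; exact: h.
Qed.

Lemma op_sec S B x i : supp S x ->
  op (sec S B) x i = if S i then op B x i else 0.
Proof.
move=> Sx; rewrite /op /sec; case: (S i) => /=; last by rewrite !mul0r !addr0.
have h j : (if S j then B i j else 0) * x j = B i j * x j.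
  by case: ifPn => // /Sx ->; rewrite !mulr0.
by rewrite !h.
Qed.

Lemma supp_op_sec S B x : supp S (op (sec S B) x).
Proof. by move=> i /negbTE Si; rewrite /op /sec Si/= !mul0r !addr0. Qed.

Lemma sec_bounded S B b : bounded_by B b -> bounded_by (sec S B) b.
Proof.
move=> Bb i j; rewrite /sec; case: ifP => // _; rewrite normc0.
exact: le_trans (cabs_ge0 _) (Bb i j).
Qed.

Lemma sec_predT B : sec predT B = B.
Proof. by []. Qed.

Lemma supp_predT x : supp predT x.
Proof. by []. Qed.

(** The slowly varying cut-off: a tent of slope 1 / (n + 1), whose commutator with a tridiagonal
    operator is of order 1 / (n + 1). *)
Definition hat (c : int) (n : nat) (i : int) : R :=
  Num.max 0 (1 - `|i - c|%:~R / n.+1%:R).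

Lemma hat01 c n i : 0 <= hat c n i <= 1.
Proof. by rewrite /hat le_max lexx/= ge_max ler01/= gerBl divr_ge0. Qed.

Lemma hat_center c n : hat c n c = 1.
Proof. by rewrite /hat subrr normr0 mul0r subr0 max_r. Qed.

Lemma hat_out c n i : n%:Z < `|i - c| -> hat c n i = 0.
Proof.
move=> h; apply: max_l; rewrite subr_le0 ler_pdivlMr// mul1r.
by rewrite -[n.+1%:R]/(n.+1%:Z%:~R) ler_int; lia.
Qed.

Lemma hat_lip c n i : `|hat c n (i + 1) - hat c n i| <= n.+1%:R^-1.
Proof.
have n0 : 0 < n.+1%:R^-1 :> R by rewrite invr_gt0.
have mx (a b d : R) : `|a - b| <= d -> `|Num.max 0 a - Num.max 0 b| <= d.
  rewrite !ler_norml => /andP[h1 h2].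
  by case: (leP 0 a); case: (leP 0 b) => *; apply/andP; split; lra.
apply: mx; rewrite opprB addrC addrA subrK -mulrBl normrM (ger0_norm (ltW n0)).
rewrite ger_pMl// -intrB -intr_norm.
by rewrite lerz1; lia.
Qed.

Lemma hat_cvg c i (e : R) : 0 < e ->
  exists N, forall n, (N <= n)%N -> `|hat c n i - 1| < e.
Proof.
move=> e0; have [N hN] : exists N, `|i - c|%:~R / e < N%:R :> R.
  by exists (Num.truncn (`|i - c|%:~R / e : R)).+1; rewrite truncnS_gt.
exists N => n Nn; have := hat01 c n i => /andP[_ h1].
rewrite ler0_norm ?subr_le0// opprB ltrBlDr -ltrBlDl.
rewrite /hat lt_max; apply/orP; right.
rewrite ltrD2l ltrN2 ltr_pdivrMr// mulrC -ltr_pdivrMr//.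
by rewrite (lt_le_trans hN)// ler_nat; lia.
Qed.

Lemma lt_epsilon (a e : R) : 0 <= a -> 0 < e -> exists n, a / n.+1%:R < e.
Proof.
move=> a0 e0; exists (Num.truncn (a / e)).
rewrite ltr_pdivrMr// mulrC -ltr_pdivrMr//; exact: truncnS_gt.
Qed.

Variable p : \bar R.
Hypothesis p1 : (1 <= p)%E.
Local Notation nm := (nm p).
Local Notation lp := (lp p).

Lemma op_bound3 B (u v w : R) x : 0 <= u -> 0 <= v -> 0 <= w ->
  (forall i, cabs (B i (i - 1)) <= u) -> (forall i, cabs (B i i) <= v) ->
  (forall i, cabs (B i (i + 1)) <= w) ->
  lp x -> lp (op B x) /\ nm (op B x) <= (u + v + w) * nm x.
Proof.
move=> u0 v0 w0 hu hv hw hx.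
have term (c : R) (f : int -> C) (k : int) : 0 <= c -> (forall i, cabs (f i) <= c) ->
    lp (fun i => f i * x (i + k)) /\ nm (fun i => f i * x (i + k)) <= c * nm x.
  move=> c0 fc; have [h1 h2] := nm_shift p1 k hx.
  have [|h3 h4] := nm_mono p1 (x := fun i => f i * x (i + k)) c0 _ h1.
    by move=> i; rewrite normcM ler_wpM2r// cabs_ge0.
  by split=> //; rewrite (le_trans h4)// ler_wpM2l.
have [h1 h2] := term _ _ (-1) u0 hu.
have [h3 h4] := term _ _ 0 v0 hv.
have [h5 h6] := term _ _ 1 w0 hw.
have [h7 h8] := nmD p1 h1 h3.
have [h9 h10] := nmD p1 h7 h5.
have -> : op B x = (fun i => B i (i - 1) * x (i - 1) + B i i * x (i + 0) +
    B i (i + 1) * x (i + 1)).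
  by apply/funext => i; rewrite addr0.
split=> //; rewrite (le_trans h10)// 2!mulrDl lerD// (le_trans h8)//.
exact: lerD.
Qed.

Lemma op_bounded B b x : bounded_by B b -> lp x ->
  lp (op B x) /\ nm (op B x) <= 3 * b * nm x.
Proof.
move=> Bb; have b0 := le_trans (cabs_ge0 _) (Bb 0 0).
have -> : 3 * b = b + b + b by ring.
exact: op_bound3.
Qed.

(** The commutator of B with multiplication by f is the matrix [E] with entries B i j (f j - f i) on
    the band, which are at most b e, while multiplication by f does not increase norms. *)
Lemma op_commutator B b (f : int -> R) e x : bounded_by B b -> 0 <= e ->
  (forall i, `|f (i + 1) - f i| <= e) -> lp x ->
  (forall i, 0 <= f i <= 1) ->
  nm (op B (fun i => real_complex R (f i) * x i)) <= nm (op B x) + 3 * (b * e) * nm x.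
Proof.
move=> Bb e0 fe hx f01.
pose E (i j : int) := if `|i - j| <= 1 then B i j * real_complex R (f j - f i) else 0.
have b0 := le_trans (cabs_ge0 _) (Bb 0 0).
have Eb : bounded_by E (b * e).
  move=> i j; rewrite /E; case: ifPn => ij; last by rewrite normc0 mulr_ge0.
  rewrite normcM cabs_real ler_pM ?cabs_ge0//.
  have [->|[->|->]] : j = i \/ j = i + 1 \/ i = j + 1 by lia.
  - by rewrite subrr normr0.
  - exact: fe.
  - by rewrite distrC fe.
have [h1 h2] := op_bounded Bb hx.
have [h3 h4] := op_bounded Eb hx.
have [|h5 h6] := nm_mono p1 (x := fun i => real_complex R (f i) * op B x i) ler01 _ h1.
  move=> i; rewrite normcM cabs_real mul1r ler_piMl ?cabs_ge0//.
  by have /andP[? ?] := f01 i; rewrite ger0_norm.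
have [_ h7] := nmD p1 h5 h3.
have -> : op B (fun i => real_complex R (f i) * x i) =
    (fun i => real_complex R (f i) * op B x i + op E x i).
  apply/funext => i; rewrite /op /E.
  by rewrite near_pred near_self near_succ !rmorphB/=; ring.
by rewrite (le_trans h7)// lerD// (le_trans h6)// mul1r.
Qed.

Definition lower_bound S B K :=
  forall x, lp x -> supp S x -> nm x <= K * nm (op (sec S B) x).

Definition onto S B :=
  forall y, lp y -> supp S y -> exists x, [/\ lp x, supp S x & op (sec S B) x = y].

(** Invertibility of the compression with a bound on the inverse, split into two halves that pass to
    limits for different reasons. *)
Definition inv_le S B K := [/\ 0 <= K, lower_bound S B K & onto S B].

Lemma nm_hat c n x : lp x ->
  lp (fun i => real_complex R (hat c n i) * x i) /\
  nm (fun i => real_complex R (hat c n i) * x i) <= nm x.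
Proof.
move=> hx; rewrite -[leRHS]mul1r; apply: nm_mono => // i.
rewrite normcM cabs_real mul1r ler_piMl ?cabs_ge0//.
by have /andP[? ?] := hat01 c n i; rewrite ger0_norm.
Qed.

Lemma op_hat B b c n x : bounded_by B b -> lp x ->
  nm (op B (fun i => real_complex R (hat c n i) * x i)) <=
  nm (op B x) + 3 * (b / n.+1%:R) * nm x.
Proof.
move=> Bb hx; apply: op_commutator => // i; [exact: hat_lip|exact: hat01].
Qed.

(** Wide tents applied to x cost an arbitrarily small commutator term. They tend to x componentwise,
    and Fatou's lemma concludes even for p = +oo, where they need not tend to x in norm. *)
Lemma lower_bound_fin S B b K : bounded_by B b -> 0 <= K ->
  (forall (L : nat) x, lp x -> supp S x -> (forall i, L%:Z < `|i| -> x i = 0) ->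
    nm x <= K * nm (op (sec S B) x)) ->
  lower_bound S B K.
Proof.
move=> Bb K0 h x hx Sx; apply/ler_addgt0Pr => e e0.
have b0 := le_trans (cabs_ge0 _) (Bb 0 0).
have x0 := nm_ge0 p1 x.
have [N hN] : exists N, K * (3 * b * nm x) / N.+1%:R < e.
  by apply: lt_epsilon => //; rewrite !mulr_ge0.
pose z n i := real_complex R (hat 0 (n + N) i) * x i.
have zx i : tends (z ^~ i) (x i).
  rewrite -[x i]mul1r; apply: tendsM; last exact: tends_cst.
  move=> d d0; have [M hM] := hat_cvg 0 i d0.
  apply: (@ultra_nat_ge _ M) => n Mn.
  by rewrite -(rmorph1 (real_complex R)) -rmorphB cabs_real hM// (leq_trans Mn)// leq_addr.
apply: (nm_fatou p1 zx _).2 => n; have [h1 h2] := nm_hat 0 (n + N) hx; split=> //.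
have : nm (z n) <= K * nm (op (sec S B) (z n)).
  apply: (h (n + N)%N) => // i => [/Sx|] hi; rewrite /z; first by rewrite hi mulr0.
  by rewrite hat_out ?subr0// mul0r.
move=> /le_trans; apply; rewrite (le_trans (ler_wpM2l K0 (op_hat _ _ (sec_bounded S Bb) hx)))//.
rewrite mulrDr lerD2l (le_trans _ (ltW hN))//.
have -> : K * (3 * (b / (n + N).+1%:R) * nm x) = K * (3 * b * nm x) / (n + N).+1%:R by ring.
rewrite ler_wpM2l ?mulr_ge0// lef_pV2 ?posrE// ler_nat; lia.
Qed.

Lemma inv_le_solve S B K y : inv_le S B K -> lp y -> supp S y ->
  exists x, [/\ lp x, supp S x, op (sec S B) x = y & nm x <= K * nm y].
Proof.
move=> [K0 lb /(_ y) h] hy Sy; have [x [hx Sx xy]] := h hy Sy.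
by exists x; split=> //; rewrite -xy; exact: lb.
Qed.

Lemma inv_le_inj S B K x y : inv_le S B K -> lp x -> lp y -> supp S x -> supp S y ->
  op (sec S B) x = op (sec S B) y -> x = y.
Proof.
move=> [K0 lb _] hx hy Sx Sy xy.
have [h1 _] := nmB p1 hx hy.
have h2 : supp S (fun i => x i - y i) by move=> i Si; rewrite Sx// Sy// subr0.
have := lb _ h1 h2; rewrite opB xy.
have -> : (fun i => op (sec S B) y i - op (sec S B) y i) = (fun=> 0).
  by apply/funext => i; rewrite subrr.
rewrite (nm0 p1).2 mulr0 => /(nm_eq0 p1 h1) xy0; apply/funext => i.
by apply/eqP; rewrite -subr_eq0 (congr1 (@^~ i) xy0).
Qed.

Definition agree (L : nat) (e : R) S B S' B' :=
  forall i j : int, `|i| <= L%:Z -> `|j| <= L%:Z -> S' i = S i /\ cabs (B' i j - B i j) < e.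

(** Approximation on every finite box; shifted windows of one matrix and finite truncations are the
    intended members of [F]. *)
Definition local_limit (F : pred int -> (int -> int -> C) -> Prop) S B :=
  forall (L : nat) (e : R), 0 < e -> exists S' B', F S' B' /\ agree L e S B S' B'.

Lemma lower_bound_limit F S B b K : bounded_by B b -> 0 <= K -> local_limit F S B ->
  (forall S' B', F S' B' -> lower_bound S' B' K) -> lower_bound S B K.
Proof.
move=> Bb K0 lim hF; apply: (lower_bound_fin Bb K0) => L x hx Sx xL.
apply/ler_addgt0Pr => e e0; have x0 := nm_ge0 p1 x.
have d0 : 0 < K * 3 * nm x + 1 by rewrite ltr_wpDl// !mulr_ge0.
(* The box exceeds the support of x by one, because [op] reaches the neighbouring rows. The
   tolerance makes the total error at most e, and its summand 1 keeps the denominator positive. *)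
have [|S' [B' [FB ag]]] := lim L.+1 (e / (K * 3 * nm x + 1)); first exact: divr_gt0.
have Sx' : supp S' x.
  move=> i Si; have [iL|] := lerP `|i| L%:Z; last exact: xL.
  by apply: Sx; have [||<- _] := ag i i; lia.
pose E (i j : int) := if (`|i| <= L.+1%:Z) && (`|j| <= L.+1%:Z)
  then sec S' B' i j - sec S B i j else 0.
have Eb : bounded_by E (e / (K * 3 * nm x + 1)).
  move=> i j; rewrite /E; case: ifPn => [/andP[hi hj]|_].
    have [Si h] := ag _ _ hi hj; have [Sj _] := ag _ _ hj hi.
    rewrite /sec Si Sj; case: ifP => _; first exact: ltW.
    by rewrite subrr normc0 divr_ge0 ?(ltW e0) ?(ltW d0).
  by rewrite normc0 divr_ge0 ?(ltW e0) ?(ltW d0).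
have [h1 h2] := op_bounded Eb hx.
have [h3 h4] := op_bounded (sec_bounded S Bb) hx.
have [_ h5] := nmD p1 h3 h1.
have := hF _ _ FB x hx Sx'.
have -> : op (sec S' B') x = (fun i => op (sec S B) x i + op E x i).
  apply/funext => i; rewrite /op.
  have h j : `|i - j| <= 1 -> sec S' B' i j * x j = sec S B i j * x j + E i j * x j.
    move=> ij; rewrite /E; case: ifPn => [_|/negP hij]; first by ring.
    by rewrite (xL j) ?mulr0 ?addr0//; rewrite ltNge; apply/negP => jL; apply: hij; lia.
  by rewrite !h ?near_pred ?near_self ?near_succ//; ring.
move=> /le_trans; apply; rewrite (le_trans (ler_wpM2l K0 h5))// mulrDr lerD2l.
rewrite (le_trans (ler_wpM2l K0 h2))//.
have -> : K * (3 * (e / (K * 3 * nm x + 1)) * nm x) = e * ((K * 3 * nm x) / (K * 3 * nm x + 1)).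
  by ring.
by rewrite ger_pMr// ler_pdivrMr// mul1r lerDl ler01.
Qed.

(** The approximate problems have solutions bounded by K times the norm of y, hence a componentwise
    limit; each row of the equation involves three components only and passes to the limit. *)
Lemma onto_limit F S B K : 0 <= K -> local_limit F S B ->
  (forall S' B', F S' B' -> inv_le S' B' K) -> onto S B.
Proof.
move=> K0 lim hF y hy Sy.
have /choice[SB hSB] : forall n : nat, exists SB : pred int * (int -> int -> C),
    F SB.1 SB.2 /\ agree n (n.+1%:R^-1) S B SB.1 SB.2.
  move=> n; have [|S' [B' h]] := lim n (n.+1%:R^-1); first by rewrite invr_gt0.
  by exists (S', B').
pose yn n i := if (SB n).1 i then y i else 0.
have ynP n : lp (yn n) /\ nm (yn n) <= nm y by exact: nm_restrict.
have yS n : supp (SB n).1 (yn n) by move=> i /negbTE Si; rewrite /yn Si.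
have /choice[xn hxn] := fun n => inv_le_solve (hF _ _ (hSB n).1) (ynP n).1 (yS n).
have xnb n : lp (xn n) /\ nm (xn n) <= K * nm y.
  have [h1 h2 h3 h4] := hxn n; split=> //.
  by rewrite (le_trans h4)// ler_wpM2l// (ynP n).2.
have [x [hx xb xnx]] := nm_compact p1 xnb.
have evS i : ultra_nat [set n | (SB n).1 i = S i].
  apply: (@ultra_nat_ge _ `|i|%N) => n hn.
  by have [||] := (hSB n).2 i i; lia.
exists x; split=> //.
  move=> i Si; apply: tends_uniq (xnx i) _; apply: tends_near (tends_cst _).
  apply: filterS (evS i) => n /= hS; have [_ + _ _] := hxn n.
  by apply; rewrite hS.
apply/funext => i.
have entry j : tends (fun n => sec (SB n).1 (SB n).2 i j) (sec S B i j).
  rewrite /sec; case: ifPn => Sij.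
    move=> e e0; have [N hN] := lt_epsilon ler01 e0.
    apply: filterS (filterI (filterI (evS i) (evS j)) (@ultra_nat_ge
      (fun n => (N <= n)%N /\ (`|i| <= n)%N /\ (`|j| <= n)%N) (N + `|i| + `|j|)%N _)).
      move=> n /= [[-> ->] [Nn [hi hj]]]; rewrite Sij.
      have [||_ h] := (hSB n).2 i j; [lia|lia|].
      rewrite (lt_trans h)// (le_lt_trans _ hN)// div1r lef_pV2 ?posrE// ler_nat; lia.
    by move=> n; lia.
  apply: tends_near (tends_cst _).
  by apply: filterS (filterI (evS i) (evS j)) => n /= [-> ->]; rewrite (negbTE Sij).
have h1 : tends (fun n => op (sec (SB n).1 (SB n).2) (xn n) i) (op (sec S B) x i).
  exact: tends_op.
apply: (tends_uniq h1); apply: tends_near (tends_cst _).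
apply: filterS (evS i) => n /= hS; have [_ _ -> _] := hxn n.
by rewrite /yn hS; case: ifPn => // /Sy ->.
Qed.

Lemma inv_le_limit F S B b K : bounded_by B b -> 0 <= K -> local_limit F S B ->
  (forall S' B', F S' B' -> inv_le S' B' K) -> inv_le S B K.
Proof.
move=> Bb K0 lim hF; split=> //; last exact: onto_limit lim hF.
by apply: (lower_bound_limit Bb K0 lim) => S' B' /hF[].
Qed.

Lemma lower_bound_reindex (f h : int -> int) S B b K : bounded_by B b -> 0 <= K ->
  cancel f h -> cancel h f ->
  (forall x, op (sec (S \o f) (fun i j => B (f i) (f j))) (x \o f) = op (sec S B) x \o f) ->
  lower_bound S B K -> lower_bound (S \o f) (fun i j => B (f i) (f j)) K.
Proof.
move=> Bb K0 fK hK opf lb x hx Sx.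
have re (g : int -> int) y : injective g -> lp y -> lp (y \o g) /\ nm (y \o g) <= nm y.
  move=> gI hy; rewrite -[nm y]mul1r; apply: (@nm_reindex _ _ p1 g) => // [i j _ _|i _].
    exact: gI.
  by rewrite mul1r.
have fI : injective f := can_inj fK.
have [h1 _] := re h _ (can_inj hK) hx.
have xhf : (x \o h) \o f = x by apply/funext => i /=; rewrite fK.
have h2 : supp S (x \o h) by move=> i Si; apply: Sx; rewrite /= hK.
have [h3 _] := op_bounded (sec_bounded S Bb) h1.
have [h4 h5] := re f _ fI h3; have [_ h6] := re h _ (can_inj hK) h4.
have := opf (x \o h); rewrite xhf => ->.
have [_ h7] := re f _ fI h1; rewrite xhf in h7.
rewrite (le_trans h7)// (le_trans (lb _ h1 h2))// ler_wpM2l// (le_trans _ h6)//.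
by rewrite le_eqVlt; apply/orP; left; apply/eqP; congr nm; apply/funext => i /=; rewrite hK.
Qed.

Lemma op_shift S B k x :
  op (sec (fun i => S (i + k)) (fun i j => B (i + k) (j + k))) (fun i => x (i + k)) =
  (fun i => op (sec S B) x (i + k)).
Proof. by apply/funext => i; rewrite /op /sec (addrAC i (-1) k) (addrAC i 1 k). Qed.

Lemma lower_bound_shift S B b K k : bounded_by B b -> 0 <= K -> lower_bound S B K ->
  lower_bound (fun i => S (i + k)) (fun i j => B (i + k) (j + k)) K.
Proof.
move=> Bb K0; apply: (lower_bound_reindex Bb K0 (addrK k) (subrK k)) => x.
exact: op_shift.
Qed.

Lemma lower_bound_reflect S B b K : bounded_by B b -> 0 <= K -> lower_bound S B K ->
  lower_bound (fun i => S (- i)) (fun i j => B (- i) (- j)) K.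
Proof.
move=> Bb K0; apply: (lower_bound_reindex Bb K0 opprK opprK) => x.
apply/funext => i; rewrite /op /sec /=.
have -> : - (i - 1) = - i + 1 by ring.
have -> : - (i + 1) = - i - 1 by ring.
by rewrite addrC [X in _ + X = _]addrC addrA.
Qed.

Lemma inv_le_shift S B b K k : bounded_by B b -> inv_le S B K ->
  inv_le (fun i => S (i + k)) (fun i j => B (i + k) (j + k)) K.
Proof.
move=> Bb [K0 lb on]; split=> // [|y hy Sy]; first exact: lower_bound_shift Bb K0 lb.
have [h1 _] := nm_shift p1 (- k) hy.
have [|x [hx Sx xy]] := on _ h1.
  by move=> i Si; apply: Sy; rewrite subrK.
exists (fun i => x (i + k)); split; first exact: (nm_shift p1 k hx).1.
  by move=> i; exact: Sx.
by rewrite op_shift xy; apply/funext => i; rewrite addrK.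
Qed.

(** Turns solvability on a ball, as supplied by Baire's theorem, into a linear bound. *)
Lemma solve_scale S B (r M : R) : 0 < r ->
  (forall y, lp y -> supp S y -> nm y <= r ->
    exists x, [/\ lp x, supp S x, op (sec S B) x = y & nm x <= M]) ->
  forall y, lp y -> supp S y ->
    exists x, [/\ lp x, supp S x, op (sec S B) x = y & nm x <= M / r * nm y].
Proof.
move=> r0 ball y hy Sy; have [y0|y0] := leP (nm y) 0.
  have -> := nm_eq0 p1 hy y0; exists (fun=> 0); split=> //.
  - exact: (nm0 p1).1.
  - by rewrite op0.
  - by rewrite (nm0 p1).2 mulr0.
have [h1 h2] := nmZ p1 (real_complex R (r / nm y)) hy.
have [||x [h3 h4 h5 h6]] := ball _ h1.
- by move=> i Si; rewrite Sy// mulr0.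
- by rewrite (le_trans h2)// cabs_real gtr0_norm ?divr_gt0// divfK// gt_eqF.
have [h7 h8] := nmZ p1 (real_complex R (nm y / r)) h3.
exists (fun i => real_complex R (nm y / r) * x i); split=> //.
- by move=> i Si; rewrite h4// mulr0.
- rewrite opZ h5; apply/funext => i; rewrite mulrA -rmorphM.
  by rewrite mulrA divfK ?gt_eqF// divff ?gt_eqF// rmorph1 mul1r.
- rewrite (le_trans h8)// cabs_real gtr0_norm ?divr_gt0//.
  by rewrite mulrAC [leRHS]mulrAC ler_wpM2r ?invr_ge0 ?(ltW r0)// mulrC ler_wpM2r// ltW.
Qed.

End Tridiagonal.

(** * Compressions to finite intervals *)

Section FiniteSection.
Variables (R : realType) (p : \bar R).
Hypothesis p1 : (1 <= p)%E.
Local Notation C := (complex R).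
Local Notation nm := (nm p).
Local Notation lp := (lp p).
Implicit Types (x y : int -> C) (B : int -> int -> C) (S : pred int).

Lemma lp_fin (L : nat) x : (forall i : int, L%:Z < `|i| -> x i = 0) -> lp x.
Proof.
move=> xL; pose s := [seq k%:Z - L%:Z | k <- iota 0 (L + L).+1].
have us : uniq s by rewrite map_inj_uniq ?iota_uniq// => k l /addIr [].
have [h _] := nm_finsupp p1 x us.
congr (lp _) : h; apply/funext => i; case: ifPn => // /negP si.
rewrite xL// ltNge; apply/negP => iL; apply: si; apply/mapP.
by exists `|(i + L%:Z)%R|%N; [rewrite mem_iota; lia|lia].
Qed.

(** An injective endomorphism of a finite-dimensional space is onto. *)
Lemma onto_fin (L : nat) S B : (forall i, S i -> `|i| <= L%:Z) ->
  (forall x, lp x -> supp S x -> op (sec S B) x = (fun=> 0) -> x = (fun=> 0)) ->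
  onto p S B.
Proof.
move=> SL inj y hy Sy; pose n := (L + L)%N.
pose emb (v : 'rV[C]_n.+1) (i : int) : C :=
  if `|i| <= L%:Z then v 0 (inord `|(i + L%:Z)%R|) else 0.
pose idx (l : 'I_n.+1) : int := l%:Z - L%:Z.
have embL v i : L%:Z < `|i| -> emb v i = 0 by rewrite /emb leNgt => ->.
have embK v l : emb v (idx l) = v 0 l.
  rewrite /emb /idx ifT; last by have := ltn_ord l; rewrite /n; lia.
  by congr (v 0 _); apply: val_inj; rewrite /= subrK inordK//=.
have idxK (i : int) : `|i| <= L%:Z -> idx (inord `|(i + L%:Z)%R|) = i.
  by move=> iL; rewrite /idx inordK /n; lia.
(* Extending by the identity off S gives an endomorphism of all families on the box of 2 L + 1
   sites, hence a square matrix whose size does not depend on S. *)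
pose T x i := if S i then op (sec S B) x i else x i.
pose M := \matrix_(k, l) T (emb (delta_mx 0 k)) (idx l).
have embE v : emb v = (fun i => \sum_k v 0 k * emb (delta_mx 0 k) i).
  apply/funext => i; rewrite /emb; case: ifP => _; last first.
    by rewrite big1// => k _; rewrite mulr0.
  rewrite {1}[v]row_sum_delta summxE; apply: eq_bigr => k _.
  by rewrite mxE.
have ME v l : (v *m M) 0 l = T (emb v) (idx l).
  rewrite mxE /T (embE v) op_sum.
  by case: ifP => Sl; apply: eq_bigr => k _; rewrite mxE /T Sl.
have Mu : M \in unitmx.
  rewrite -row_free_unit; apply: inj_row_free => v vM.
  have Sv : supp S (emb v).
    move=> i Si; have [iL|] := lerP `|i| L%:Z; last exact: embL.
    have := ME v (inord `|(i + L%:Z)%R|).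
    by rewrite vM mxE idxK// /T (negbTE Si).
  have /(congr1 (fun f => f (idx _))) h : emb v = (fun=> 0).
    apply: inj => //; first exact: lp_fin (embL v).
    apply/funext => i; have [Si|/supp_op_sec//] := boolP (S i).
    have := ME v (inord `|(i + L%:Z)%R|).
    by rewrite vM mxE idxK ?SL// /T Si.
  by apply/rowP => l; rewrite mxE -embK h.
pose v := (\row_l y (idx l)) *m invmx M.
have Tv i : `|i| <= L%:Z -> T (emb v) i = y i.
  move=> iL; rewrite -{1}(idxK i iL) -ME /v mulmxKV// mxE idxK//.
have Sv : supp S (emb v).
  move=> i Si; have [iL|] := lerP `|i| L%:Z; last exact: embL.
  by have := Tv _ iL; rewrite /T (negbTE Si) => ->; exact: Sy.
exists (emb v); split=> //; first exact: lp_fin (embL v).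
apply/funext => i; have [Si|Si] := boolP (S i).
  by rewrite -(Tv i) ?SL// /T Si.
by rewrite Sy// supp_op_sec.
Qed.

Lemma inv_le_fin (L : nat) S B K : (forall i, S i -> `|i| <= L%:Z) -> 0 <= K ->
  lower_bound p S B K -> inv_le p S B K.
Proof.
move=> SL K0 lb; split=> //; apply: (onto_fin SL) => x hx Sx x0.
have := lb x hx Sx; rewrite x0 (nm0 p1).2 mulr0; exact: nm_eq0.
Qed.

(** Each of the two pieces of x costs a commutator term 3 c K / (b - a) times the norm of x.
    Together they amount to at most half of that norm and are absorbed, which turns 2 K into 4 K. *)
Lemma lower_bound_cut (a b : int) B c K :
  bounded_by B c -> 0 <= K -> a < b -> 12 * c * K <= (b - a)%:~R ->
  lower_bound p (fun i => a <= i) B K -> lower_bound p (fun i => i <= b) B K ->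
  lower_bound p (fun i => a <= i <= b) B (4 * K).
Proof.
move=> Bc K0 ab cK lba lbb x hx Sx.
set S := fun i => _ in Sx *; set d : R := (b - a)%:~R in cK.
have d0 : 0 < d by rewrite ltr0z; lia.
have c0 := le_trans (cabs_ge0 _) (Bc 0 0).
(* x = f x + (1 - f) x, and the two pieces see only the end a, respectively b. *)
pose f (i : int) : R := if i <= a then 1 else if b <= i then 0 else (b - i)%:~R / d.
(* Passing from the interval to a half line adds rows beyond the other end. The piece vanishes at
   the neighbours of these rows, so they contribute nothing. *)
have sideA (i : int) : a <= i -> ~~ (a <= i <= b) ->
    f (i - 1) * ((a <= i - 1 <= b)%R : bool)%:R = 0 /\
    f (i + 1) * ((a <= i + 1 <= b)%R : bool)%:R = 0.
  clear - ab => ai nab; have bi : b < i by lia.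
  split; last by rewrite (_ : (_ && _) = false) ?mulr0//; lia.
  by rewrite /f ifF ?ifT ?mul0r//; lia.
have sideB (i : int) : i <= b -> ~~ (a <= i <= b) ->
    (1 - f (i - 1)) * ((a <= i - 1 <= b)%R : bool)%:R = 0 /\
    (1 - f (i + 1)) * ((a <= i + 1 <= b)%R : bool)%:R = 0.
  clear - ab => ib nab; have ai : i < a by lia.
  split; first by rewrite (_ : (_ && _) = false) ?mulr0//; lia.
  by rewrite /f ifT ?subrr ?mul0r//; lia.
have f01 i : 0 <= f i <= 1.
  rewrite /f; case: ifP => h1; first by rewrite ler01 lexx.
  case: ifP => h2; first by rewrite ler01 lexx.
  apply/andP; split; first by rewrite divr_ge0 ?(ltW d0)// ler0z; lia.
  by rewrite ler_pdivrMr// mul1r ler_int; lia.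
have flip i : `|f (i + 1) - f i| <= d^-1.
  have di : 0 <= d^-1 by rewrite invr_ge0 ltW.
  have dd : (b - a)%:~R / d = 1 by rewrite divff// gt_eqF.
  have step j : (b - (j + 1))%:~R / d - (b - j)%:~R / d = - d^-1.
    rewrite -mulrBl -intrB (_ : b - (j + 1) - (b - j) = -1); last by lia.
    by rewrite mulrN1z mulN1r.
  have fE j : a <= j <= b -> f j = (b - j)%:~R / d.
    move=> /andP[h1 h2]; rewrite /f; case: ifP => h3.
      by have -> : j = a by lia; rewrite dd.
    by case: ifP => h4 //; rewrite (_ : b - j = 0) ?mul0r//; lia.
  have [h1|h1] := ltP i a.
    by rewrite /f !ifT ?subrr ?normr0//; lia.
  have [h2|h2] := leP b i.
    have -> : f (i + 1) = 0 by rewrite /f ifF ?ifT//; lia.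
    by rewrite (_ : f i = 0) ?subrr ?normr0// /f ifF ?ifT//; lia.
  by rewrite !fE ?step ?normrN ?ger0_norm//; lia.
have g01 i : 0 <= 1 - f i <= 1 by have := f01 i; lra.
have glip i : `|(1 - f (i + 1)) - (1 - f i)| <= d^-1.
  by rewrite (_ : _ - _ = - (f (i + 1) - f i)) ?normrN//; ring.
have di : 0 <= d^-1 by rewrite invr_ge0 ltW.
have cut (g : int -> R) S' : (forall i, 0 <= g i <= 1) ->
    (forall i, `|g (i + 1) - g i| <= d^-1) -> lower_bound p S' B K ->
    (forall i, S i -> S' i) ->
    (forall i, S' i -> ~~ S i -> g (i - 1) * (S (i - 1))%:R = 0 /\
       g (i + 1) * (S (i + 1))%:R = 0) ->
    nm (fun i => real_complex R (g i) * x i) <=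
      K * (nm (op (sec S B) x) + 3 * (c * d^-1) * nm x).
  move=> h1 h2 h3 SS' h4.
  apply: le_trans (ler_wpM2l K0 (op_commutator p1 (sec_bounded S Bc) di h2 hx h1)).
  set z := fun i => _.
  have zS : supp S z by move=> i Si; rewrite /z Sx// mulr0.
  have zS' : supp S' z by move=> i Si; apply: zS; apply: contra Si; exact: SS'.
  have -> : op (sec S B) z = op (sec S' B) z.
    apply/funext => i; rewrite !op_sec//; case: ifPn => Si; first by rewrite SS'.
    case: ifPn => // S'i; have [g1 g2] := h4 i S'i Si.
    have zz j : g j * (S j)%:R = 0 -> z j = 0.
      have [Sj|Sj _] := boolP (S j); last exact: zS.
      by rewrite mulr1 /z => ->; rewrite rmorph0 mul0r.
    by rewrite /op (zz _ g1) (zz _ g2) (zS _ Si) !mulr0 !addr0.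
  apply: h3 => //; apply: (nm_mono p1 ler01 _ hx).1 => i.
  rewrite normcM cabs_real mul1r ler_piMl ?cabs_ge0//.
  by have /andP[? ?] := h1 i; rewrite ger0_norm.
have h1 := cut f (fun i => a <= i) f01 flip lba.
have h2 := cut (fun i => 1 - f i) (fun i => i <= b) g01 glip lbb.
have {}h1 := h1 _ _; have {}h2 := h2 _ _.
have lpx (g : int -> R) : (forall i, 0 <= g i <= 1) -> lp (fun i => real_complex R (g i) * x i).
  move=> g01'; apply: (nm_mono p1 ler01 _ hx).1 => i.
  rewrite normcM cabs_real mul1r ler_piMl ?cabs_ge0//.
  by have /andP[? ?] := g01' i; rewrite ger0_norm.
have [_ h3] := nmD p1 (lpx _ f01) (lpx _ g01).
move: h3; rewrite (_ : (fun i => _ + _) = x); last first.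
  by apply/funext => i; rewrite -mulrDl -rmorphD addrC subrK mul1r.
have x0 := nm_ge0 p1 x; have y0 := nm_ge0 p1 (op (sec S B) x).
have cK' : 6 * (c * K) * d^-1 <= 2^-1 by rewrite ler_pdivrMr//; lra.
have xx : 6 * (c * K) * d^-1 * nm x <= 2^-1 * nm x by rewrite ler_wpM2r.
move=> h3; suff : nm x <= 2 * K * nm (op (sec S B) x) + 6 * (c * K) * d^-1 * nm x by lra.
rewrite (le_trans h3)//.
have -> : 2 * K * nm (op (sec S B) x) + 6 * (c * K) / d * nm x =
  K * (nm (op (sec S B) x) + 3 * (c * d^-1) * nm x) +
  K * (nm (op (sec S B) x) + 3 * (c * d^-1) * nm x) by ring.
apply: lerD.
  by apply: h1 => i; rewrite /S; [case/andP|exact: sideA].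
by apply: h2 => i; rewrite /S; [case/andP|exact: sideB].
Qed.

End FiniteSection.

(** * Decay of inverses and transposition *)

Section Transpose.
Variables (R : realType) (p : \bar R).
Hypothesis p1 : (1 <= p)%E.
Local Notation C := (complex R).
Local Notation nm := (nm p).
Local Notation lp := (lp p).
Implicit Types (x y : int -> C) (B : int -> int -> C) (S : pred int).

Definition trmat B : int -> int -> C := fun i j => B j i.

(* Combes--Thomas: conjugating by the bounded weight (1 + e)^min(|i - j|, N)
   perturbs the operator by a multiple of e only. *)
Lemma inverse_decay S B b K e d j : bounded_by B b -> inv_le p S B K ->
  0 <= e -> 3 * (b * e) * K <= 2^-1 -> lp d -> supp S d ->
  op (sec S B) d = (fun i => if i == j then 1 else 0) ->
  forall i, cabs (d i) * (1 + e) ^+ `|i - j|%N <= 2 * K.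
Proof.
move=> Bb [K0 lb _] e0 beK hd Sd dj i0.
have b0 := le_trans (cabs_ge0 _) (Bb 0 0).
have r1 : 1 <= 1 + e by lra.
(* Truncating the exponent at the distance from i0 to j keeps the weight bounded, so that z stays in
   l^p, and leaves the weight at i0 unchanged. *)
pose m (i : int) := minn `|i - j|%N `|i0 - j|%N.
pose w i := (1 + e) ^+ (m i).
have w1 i : 1 <= w i by rewrite exprn_ege1.
have wlip i k : `|i - k| <= 1 -> `|w k - w i| <= e * w k.
  move=> ik; rewrite /w.
  have [->|[->|hm]] : m i = m k \/ m i = (m k).+1 \/ m k = (m i).+1 by rewrite /m; lia.
  - by rewrite subrr normr0 mulr_ge0 ?exprn_ge0//; lra.
  - rewrite exprS mulrDl mul1r opprD addrA subrr add0r normrN ger0_norm//.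
    by rewrite mulr_ge0 ?exprn_ge0//; lra.
  rewrite hm exprS mulrDl mul1r addrAC subrr add0r ger0_norm.
    by rewrite mulrDr lerDl mulr_ge0// mulr_ge0// exprn_ge0//; lra.
  by rewrite mulr_ge0 ?exprn_ge0//; lra.
pose z i := real_complex R (w i) * d i.
have [hz _] : lp z /\ nm z <= (1 + e) ^+ `|i0 - j|%N * nm d.
  apply: nm_mono => // [|i]; first by rewrite exprn_ge0//; lra.
  rewrite normcM cabs_real ler_wpM2r ?cabs_ge0// ger0_norm; last by have := w1 i; lra.
  by rewrite /w ler_weXn2l// geq_minr.
have Sz : supp S z by move=> i Si; rewrite /z Sd// mulr0.
(* The difference between the compression and its conjugate by the weight w. The right-hand side is
   not affected by the weight, since w j = 1. *)
pose E (i k : int) := if `|i - k| <= 1 then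
  sec S B i k * real_complex R (1 - w i / w k) else 0.
have Eb : bounded_by E (b * e).
  move=> i k; rewrite /E; case: ifPn => ik; last by rewrite normc0 mulr_ge0.
  rewrite normcM cabs_real ler_pM ?cabs_ge0//; first exact: sec_bounded.
  have wk0 : 0 < w k by have := w1 k; lra.
  have -> : 1 - w i / w k = (w k - w i) / w k by rewrite mulrBl divff ?gt_eqF.
  rewrite normrM normfV (gtr0_norm wk0) ler_pdivrMr//.
  exact: wlip.
have [h1 h2] := op_bounded p1 Eb hz.
have [h3 h4] := nm_delta p1 j (1 : C).
have [_ h5] := nmD p1 h3 h1.
have := lb _ hz Sz.
have -> : op (sec S B) z = (fun i => (if i == j then 1 else 0) + op E z i).
  apply/funext => i.
  have -> : (if i == j then 1 else 0) = real_complex R (w i) * op (sec S B) d i.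
    rewrite dj; case: eqP => [->|]; last by rewrite mulr0.
    by rewrite mulr1 /w /m subrr absz0 min0n expr0.
  rewrite /op.
  have term k : `|i - k| <= 1 -> sec S B i k * z k =
      real_complex R (w i) * (sec S B i k * d k) + E i k * z k.
    move=> ik; rewrite /E ik /z rmorphB rmorphM fmorphV rmorph1.
    have wk0 : real_complex R (w k) != 0.
      by rewrite fmorph_eq0; have := w1 k; case: eqP => // ->; lra.
    by field.
  by rewrite !term ?near_pred ?near_self ?near_succ//; ring.
rewrite normc1 in h4.
have z0 := nm_ge0 p1 z.
have bz : 3 * (b * e) * K * nm z <= 2^-1 * nm z by rewrite ler_wpM2r.
(* By the choice of e the perturbation is at most half the norm of z and is absorbed, so this norm
   is at most 2 K. *)
move=> h6; have h7 : nm z <= K * (1 + 3 * (b * e) * nm z).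
  by rewrite (le_trans h6)// ler_wpM2l// (le_trans h5)// lerD.
have : cabs (z i0) <= 2 * K by rewrite (le_trans (cabs_le_nm p1 i0 hz))//; lra.
rewrite normcM cabs_real /w /m minnn ger0_norm; last by rewrite exprn_ge0//; lra.
by rewrite mulrC.
Qed.

Lemma geometric_bound (q : R) n : 0 <= q < 1 -> \sum_(k < n) q ^+ k <= (1 - q)^-1.
Proof.
move=> /andP[q0 q1]; have h : 0 < 1 - q by lra.
rewrite -(ler_pM2r h) mulVf ?gt_eqF// mulrC -opprB mulNr -subrX1 opprB.
by rewrite gerBl exprn_ge0.
Qed.

Lemma geometric_bound2 (q : R) n : 0 <= q < 1 ->
  \sum_(k < n + n.+1) q ^+ `|k%:Z - n%:Z|%N <= 2 * (1 - q)^-1.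
Proof.
move=> q01; have q0 : 0 <= q by case/andP: q01.
have -> : 2 * (1 - q)^-1 = (1 - q)^-1 + (1 - q)^-1 by ring.
rewrite big_split_ord/=; apply: lerD.
  apply: le_trans (geometric_bound n.+1 q01).
  rewrite (reindex_inj rev_ord_inj)/= big_ord_recl expr0 -[leLHS]add0r lerD//.
  apply: ler_sum => k _; rewrite /= /bump/= add1n.
  by have kn := ltn_ord k; rewrite (_ : `|_|%N = k.+1)//; lia.
apply: le_trans (geometric_bound n.+1 q01); apply: ler_sum => k _.
by rewrite (_ : `|_|%N = k)//=; lia.
Qed.

(** Summation by parts: the difference of the summands telescopes, and the boundary terms contain
    values of x at the ends only. *)
Lemma op_pairing (Q : int -> int -> C) x d (c : int) n :
  x (c - 1) = 0 -> x c = 0 -> x (c + n%:Z) = 0 -> x (c + n%:Z - 1) = 0 ->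
  \sum_(k < n) op (trmat Q) x (c + k%:Z) * d (c + k%:Z) =
  \sum_(k < n) x (c + k%:Z) * op Q d (c + k%:Z).
Proof.
move=> x1 x2 x3 x4; apply/eqP; rewrite -subr_eq0 -sumrB; apply/eqP.
pose g (a b : int) := Q a b * x a * d b.
pose h (k : nat) := g (c + k%:Z) (c + k%:Z - 1) - g (c + k%:Z - 1) (c + k%:Z).
rewrite (eq_bigr (fun k : 'I_n => h k.+1 - h k)).
  rewrite -(big_mkord xpredT (fun k => h k.+1 - h k)) telescope_sumr//.
  by rewrite /h /g !addr0 x1 x2 x3 x4 !mulr0 !mul0r !subrr.
move=> k _; rewrite /h /g /op /trmat.
have -> : c + k.+1%:Z - 1 = c + k%:Z by lia.
have -> : c + k.+1%:Z = c + k%:Z + 1 by lia.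
by ring.
Qed.

(** If y is the transposed compression applied to x, pairing with the column d i of the inverse
    recovers x i as the sum of y k times d i k. By exponential decay the diagonals of this matrix
    have summable bounds, which works for all p without duality and depends on b and K only. *)
Lemma lower_bound_transpose b K : 0 <= K -> exists K', 0 <= K' /\
  forall S B, bounded_by B b -> inv_le p S B K -> lower_bound p S (trmat B) K'.
Proof.
move=> K0; have [b0|b0] := ltP b 0.
  exists 0; split=> // S B Bb; have := le_trans (cabs_ge0 _) (Bb 0 0); lra.
(* Small enough for the hypothesis of [inverse_decay]; the summands 1 keep the denominator
   positive. *)
pose e := (6 * (b + 1) * (K + 1))^-1.
have e0 : 0 < e by rewrite invr_gt0 !mulr_gt0//; lra.
have eE : e * (6 * (b + 1) * (K + 1)) = 1 by rewrite mulVf// gt_eqF// !mulr_gt0//; lra.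
have beK : 3 * (b * e) * K <= 2^-1.
  have : 3 * (b * e) * K <= 3 * ((b + 1) * e) * (K + 1).
    by rewrite ler_pM// ?mulr_ge0// ?(ltW e0)// ?ler_wpM2l// ?ler_wpM2r// ?(ltW e0)//; lra.
  by move/le_trans; apply; lra.
pose q := (1 + e)^-1.
have q01 : 0 <= q < 1 by rewrite invr_ge0 invf_lt1; lra.
exists (2 * K * (2 * (1 - q)^-1)); split.
  by rewrite !mulr_ge0 ?invr_ge0//; lra.
move=> S B Bb iB; apply: (lower_bound_fin p1 (b := b)) => [i j||]; first exact: Bb.
  by rewrite !mulr_ge0 ?invr_ge0//; lra.
move=> L x hx Sx xL.
have /choice[d hd] : forall i, exists d, S i -> [/\ lp d, supp S d &
    op (sec S B) d = (fun l => if l == i then 1 else 0)].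
  move=> i; have [Si|nSi] := boolP (S i); last by exists (fun=> 0).
  have [_ _ on] := iB.
  have [|d [h1 h2 h3]] := on _ (nm_delta p1 i (1 : C)).1; last by exists d.
  by move=> l Sl; case: eqP => // li; rewrite -li (negbTE Sl) in Si.
have -> : sec S (trmat B) = trmat (sec S B).
  by apply/funext => i; apply/funext => l; rewrite /sec /trmat andbC.
set y := op _ x.
have [hy _] : lp y /\ nm y <= 3 * b * nm x.
  by apply: op_bounded => // i l; exact: sec_bounded.
(* For |i| <= L the range from i - n to i + n passes the support of x at both ends, as [op_pairing]
   demands. Then [f k] is the contribution of the diagonal with offset k - n. *)
pose n := (2 * L + 3)%N.
pose f (k : 'I_(n + n.+1)) (i : int) : C := if S i && (`|i| <= L%:Z) then
  y (i - n%:Z + k%:Z) * d i (i - n%:Z + k%:Z) else 0.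
have -> : x = (fun i => \sum_k f k i).
  apply/funext => i; have [/andP[Si iL]|h] := boolP (S i && (`|i| <= L%:Z)); last first.
    rewrite big1 => [|k _]; last by rewrite /f (negbTE h).
    move: h; rewrite negb_and -ltNge => /orP[h|h]; [exact: Sx|exact: xL].
  have [h1 h2 h3] := hd i Si.
  rewrite (eq_bigr (fun k : 'I__ => y (i - n%:Z + k%:Z) * d i (i - n%:Z + k%:Z))); last first.
    by move=> k _; rewrite /f Si iL.
  rewrite (@op_pairing _ x); try by apply: xL; rewrite /n; clear - iL; lia.
  have hn : (n < n + n.+1)%N by clear; lia.
  rewrite h3 (bigD1 (Ordinal hn))//= subrK eqxx mulr1 big1 ?addr0// => k.
  rewrite -val_eqE/= => kn; rewrite ifF ?mulr0//; apply/negbTE.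
  by apply: contra kn => /eqP h; apply/eqP; clear - h; lia.
have fb k : lp (f k) /\ nm (f k) <= 2 * K * q ^+ `|k%:Z - n%:Z|%N * nm y.
  have [h1 h2] := nm_shift p1 (- n%:Z + k%:Z) hy.
  have q0 : 0 <= q by case/andP: q01.
  have c0 : 0 <= 2 * K * q ^+ `|k%:Z - n%:Z|%N by rewrite !mulr_ge0// exprn_ge0.
  have [|h3 h4] := nm_mono p1 (x := f k) c0 _ h1.
    move=> i; rewrite /f addrA; case: ifPn => [/andP[Si _]|_]; last first.
      by rewrite normc0 mulr_ge0// cabs_ge0.
    rewrite normcM mulrC ler_wpM2r ?cabs_ge0//.
    have [h5 h6 h7] := hd i Si.
    have := inverse_decay Bb iB (ltW e0) beK h5 h6 h7 (i - n%:Z + k%:Z).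
    rewrite (_ : `|(i - n%:Z + k%:Z - i)%R|%N = `|k%:Z - n%:Z|%N); last by clear; lia.
    rewrite /q exprVn ler_pdivlMr// exprn_gt0//; lra.
  by split=> //; rewrite (le_trans h4)// ler_wpM2l.
have [|_ h] := nm_sum p1 (s := index_enum 'I_(n + n.+1)) (f := f)
   (c := fun k => 2 * K * q ^+ `|k%:Z - n%:Z|%N * nm y); first by move=> k _; exact: fb.
rewrite (le_trans h)// -mulr_suml ler_wpM2r ?nm_ge0// -mulr_sumr ler_wpM2l ?mulr_ge0//.
exact: geometric_bound2.
Qed.

End Transpose.

(** * Baire's theorem *)

Section Baire.
Variables (R : realType) (p : \bar R).
Hypothesis p1 : (1 <= p)%E.
Local Notation C := (complex R).
Local Notation nm := (nm p).
Local Notation lp := (lp p).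

(* Baire's theorem for sets stable under (x, y) |-> (x - y) / 2: if a set misses
   a small z, then it misses s + z or s - z. *)
Lemma baire_symmetric (F : nat -> (int -> C) -> Prop) :
  (forall m x, lp x ->
     (forall e : R, 0 < e -> exists y, [/\ lp y, F m y & nm (fun i => y i - x i) <= e]) ->
     F m x) ->
  (forall m x y, lp x -> lp y -> F m x -> F m y ->
     F m (fun i => real_complex R (2^-1) * (x i - y i))) ->
  (forall x, lp x -> exists m, F m x) ->
  exists m (r : R), 0 < r /\ forall x, lp x -> nm x <= r -> F m x.
Proof.
move=> closedF midF cover; apply: contrapT => noball.
have miss m (r : R) : 0 < r -> exists z, [/\ lp z, nm z <= r & ~ F m z].
  move=> r0; apply: contrapT => nz; apply: noball; exists m, r; split=> // x hx xr.
  by apply: contrapT => nF; apply: nz; exists x.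
(* A state is the centre and the radius of a ball; [step m] passes to a ball inside it, of at most
   half the radius, that misses [F m]. *)
pose good (s : (int -> C) * R) := lp s.1 /\ 0 < s.2.
pose step m (s t : (int -> C) * R) := [/\ good t, t.2 <= s.2 / 2,
  nm (fun i => t.1 i - s.1 i) <= s.2 / 2 &
  forall x, lp x -> nm (fun i => x i - t.1 i) <= t.2 -> ~ F m x].
have stepP m s : exists t, good s -> step m s t.
  have [[hs r0]|ns] := pselect (good s); last by exists s.
  have r2 : 0 < s.2 / 2 by lra.
  have [z [hz zr nFz]] := miss m _ r2.
  have [t [ht tz nFt]] : exists t, [/\ lp t, nm (fun i => t i - s.1 i) <= s.2 / 2 & ~ F m t].
    have [h1 _] := nmD p1 hs hz; have [h2 _] := nmB p1 hs hz.
    have [F1|nF1] := pselect (F m (fun i => s.1 i + z i)); last first.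
      exists (fun i => s.1 i + z i); split=> //.
      by rewrite (_ : (fun i => _) = z)//; apply/funext => i; ring.
    exists (fun i => s.1 i - z i); split=> //.
      rewrite (_ : (fun i => _) = fun i => - z i); last by apply/funext => i; ring.
      exact: le_trans (nmN p1 hz).2 zr.
    move=> F2; apply: nFz; have := midF m _ _ h1 h2 F1 F2.
    rewrite (_ : (fun i => _) = z)//; apply/funext => i.
    have -> : s.1 i + z i - (s.1 i - z i) = (real_complex R 2) * z i.
      by rewrite (rmorphMn _ 2 1) rmorph1; ring.
    by rewrite mulrA -rmorphM mulVf ?rmorph1 ?mul1r.
  have [e [e0 he]] : exists e : R, 0 < e /\ forall y, lp y ->
      nm (fun i => y i - t i) <= e -> ~ F m y.
    apply: contrapT => ne; apply: nFt; apply: closedF => // e e0.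
    apply: contrapT => ny; apply: ne; exists e; split=> // y hy ye Fy.
    by apply: ny; exists y.
  exists (t, Num.min e (s.2 / 2)) => _; split=> //=.
  - by split=> //=; rewrite lt_min e0.
  - by rewrite ge_min lexx orbT.
  - by move=> x hx; rewrite le_min => /andP[xe _]; exact: he.
have {stepP} /choice[g gP] : forall ms : nat * ((int -> C) * R),
    exists t, good ms.2 -> step ms.1 ms.2 t by move=> ms; exact: stepP.
pose st := fix st n := if n is k.+1 then g (k, st k) else (fun=> 0, 1).
have stG n : good (st n).
  elim: n => [|n ih]; first by split=> //=; exact: (nm0 p1).1.
  by have [] := gP (n, st n) ih.
have stS n : step n (st n) (st n.+1) := gP (n, st n) (stG n).
have near n k : nm (fun i => (st (n + k)%N).1 i - (st n).1 i) <= (st n).2 - (st (n + k)%N).2.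
  elim: k => [|k ih].
    rewrite addn0 subrr (_ : (fun i => _) = fun=> 0) ?(nm0 p1).2//.
    by apply/funext => i; rewrite subrr.
  rewrite addnS; have [_ h1 h2 _] := stS (n + k)%N.
  have [hn _] := stG n; have [hk _] := stG (n + k)%N; have [hk1 _] := stG (n + k).+1.
  have [_ h3] := nmD p1 (nmB p1 hk1 hk).1 (nmB p1 hk hn).1.
  rewrite (_ : (fun i => _) = (fun i => ((st (n + k).+1).1 i - (st (n + k)%N).1 i) +
    ((st (n + k)%N).1 i - (st n).1 i))); last by apply/funext => i; ring.
  lra.
have st1 n : lp (st n).1 /\ nm (st n).1 <= 1.
  split; first exact: (stG n).1.
  have := near 0%N n; rewrite add0n/= (_ : (fun i => _) = (st n).1).
    by have [_] := stG n; lra.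
  by apply/funext => i; rewrite subr0.
(* Completeness is replaced by a componentwise limit of the centres, which lies in every ball by
   Fatou's lemma. *)
have [l [hl _ lim]] := nm_compact p1 st1.
have ln n : nm (fun i => l i - (st n).1 i) <= (st n).2.
  have [hn _] := stG n.
  apply: (@nm_fatou _ p p1 (fun k i => (st (n + (k - n))%N).1 i - (st n).1 i) _ _ _ _).2.
    move=> i; apply: tendsD; last exact: tends_cst.
    apply: tends_near (lim i); apply: (@ultra_nat_ge _ n) => k nk /=.
    by rewrite subnKC.
  move=> k; have [hk h0] := stG (n + (k - n))%N; split; first exact: (nmB p1 hk hn).1.
  by rewrite (le_trans (near _ _))// gerBl ltW.
have [m Fm] := cover l hl.
have [_ _ _] := stS m; move=> /(_ l hl (ln m.+1)); exact.
Qed.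

End Baire.

(** * Matrices over other index sets *)

Section Transfer.
Variable R : realType.
Local Notation C := (complex R).

Variables (I : choiceType) (pos : I -> int) (g : int -> I) (S : pred int).
Hypotheses (Spos : forall i, S (pos i)) (posK : cancel pos g)
  (gK : forall k, S k -> pos (g k) = k).

(** Families on I become families on the integers supported in S; [g] inverts [pos] there, and its
    values off S do not enter. *)
Definition ext (x : I -> C) : int -> C := fun k => if S k then x (g k) else 0.

Lemma supp_ext x : supp S (ext x).
Proof. by move=> k /negbTE Sk; rewrite /ext Sk. Qed.

Lemma ext_pos x i : ext x (pos i) = x i.
Proof. by rewrite /ext Spos posK. Qed.

Lemma ext_restrict (z : int -> C) : supp S z -> ext (fun i => z (pos i)) = z.
Proof.
move=> Sz; apply/funext => k; rewrite /ext; case: ifPn => [/gK ->//|Sk].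
by rewrite Sz.
Qed.

Lemma ext_inj x y : ext x = ext y -> x = y.
Proof. by move=> xy; apply/funext => i; rewrite -!ext_pos xy. Qed.

(* The entries outside S x S are filled in so that the result lies in M(U, V, W). *)
Definition ext_mx (u v w : C) (B : I -> I -> C) (k l : int) : C :=
  if S k && S l then B (g k) (g l) else
  if k == l + 1 then u else if k == l then v else if l == k + 1 then w else 0.

Lemma ext_mxP U V W u v w B : tridiagonal pos U V W B -> U u -> V v -> W w ->
  Mbi U V W (ext_mx u v w B).
Proof.
move=> [BU BV BW B0] Uu Vv Ww; split=> [k l kl|k|k l kl|k l kl]; rewrite /ext_mx.
- by case: ifP => [/andP[Sk Sl]|_]; [apply: BU; rewrite !gK|rewrite kl eqxx].
- case: ifP => _; first exact: BV.
  by rewrite eqxx ifF//; lia.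
- case: ifP => [/andP[Sk Sl]|_]; first by apply: BW; rewrite !gK.
  by rewrite kl eqxx !ifF//; lia.
- case: ifP => [/andP[Sk Sl]|_]; first by apply: B0; rewrite !gK.
  by rewrite !ifF//; lia.
Qed.

Variables (U V W : set C) (u v w : C) (B : I -> I -> C).
Hypothesis triB : tridiagonal pos U V W B.
Local Notation eB := (ext_mx u v w B).

Lemma matop_ext x : ext (matop B x) = op (sec S eB) (ext x).
Proof.
apply/funext => k; have [Sk|Sk] := boolP (S k); last first.
  by rewrite supp_ext// supp_op_sec.
rewrite op_sec ?Sk//; last exact: supp_ext.
rewrite {1}/ext Sk /matop.
have [_ _ _ B0] := triB.
pose s := [seq g l | l <- [:: k - 1; k; k + 1] & S l].
rewrite (@fsbigE _ _ _ _ _ s)//.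
- rewrite (eq_bigl xpredT) => [|i]; last by rewrite in_setT.
  rewrite /s big_map big_filter !big_cons big_nil /= addr0 /op.
  have h l : S l -> eB k l * ext x l = B (g k) (g l) * x (g l).
    by move=> Sl; rewrite /ext_mx /ext Sk Sl.
  have h0 l : ~~ S l -> eB k l * ext x l = 0.
    by move=> Sl; rewrite supp_ext// mulr0.
  rewrite Sk (h k)// -addrA.
  by case: (boolP (S (k - 1))) => S1; case: (boolP (S (k + 1))) => S2;
    rewrite ?(h _ S1) ?(h0 _ S1) ?(h _ S2) ?(h0 _ S2) ?add0r ?addr0.
- rewrite map_inj_in_uniq ?filter_uniq//.
    by rewrite /= !inE; lia.
  by move=> i j; rewrite !mem_filter => /andP[Si _] /andP[Sj _] /(congr1 pos); rewrite !gK.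
- move=> j _ js; rewrite B0 ?mul0r// gK// ltNge; apply/negP => h.
  move/negP: js; apply; apply/mapP; exists (pos j); last by rewrite posK.
  by rewrite mem_filter Spos !inE; lia.
Qed.

Lemma matop_lin (a : C) x y :
  matop B (fun i => a * x i + y i) = (fun i => a * matop B x i + matop B y i).
Proof.
apply: ext_inj; rewrite matop_ext; apply/funext => k.
have -> : ext (fun i => a * x i + y i) = (fun i => a * ext x i + ext y i).
  by apply/funext => i; rewrite /ext; case: ifP => // _; rewrite mulr0 addr0.
rewrite opZD -!matop_ext /ext; case: ifP => // _; by rewrite mulr0 addr0.
Qed.

Variable p : \bar R.
Hypothesis p1 : (1 <= p)%E.
Local Notation nm := (nm p).
Local Notation lp := (lp p).

Lemma lpnorm_ext_le x c : (lpnorm p (ext x) <= c%:E)%E <-> (lpnorm p x <= c%:E)%E.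
Proof.
split=> h; rewrite -[c]mul1r.
  apply: (lpnorm_le_reindex p1 (g 0) (g := pos) _ _ _ h) => //.
  - by move=> i j _ _ /(congr1 g); rewrite !posK.
  - by move=> i _; rewrite ext_pos mul1r.
apply: (lpnorm_le_reindex p1 0 (g := g) _ _ _ h) => //.
- move=> i j; rewrite /ext; case: ifP => [Si _|]; last by rewrite eqxx.
  by case: ifP => [Sj _ /(congr1 pos)|]; rewrite ?eqxx// !gK.
- by move=> i; rewrite /ext mul1r; case: ifP => //; rewrite eqxx.
Qed.

Lemma lpnorm_ext x : lpnorm p (ext x) = lpnorm p x.
Proof.
have le_all (a b : \bar R) : (0 <= a)%E ->
    (forall c : R, (a <= c%:E)%E -> (b <= c%:E)%E) -> (b <= a)%E.
  by case: a => [r _ h|_ _|//]; [exact: h|rewrite leey].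
apply/eqP; rewrite eq_le; apply/andP; split; apply: le_all.
- exact: lpnorm_ge0 (g 0) _.
- by move=> c; rewrite lpnorm_ext_le.
- exact: lpnorm_ge0 (0 : int) _.
- by move=> c; rewrite lpnorm_ext_le.
Qed.

Lemma lp_ext x : lp (ext x) = lp x.
Proof. by rewrite /Defs.lp/= lpnorm_ext. Qed.

Lemma lpnorm_nm x : lp x -> lpnorm p x = (nm (ext x))%:E.
Proof.
move=> hx; rewrite -lpnorm_ext /nm fineK// ge0_fin_numE ?lpnorm_ge0//.
  by move: hx; rewrite -lp_ext.
exact: (0 : int).
Qed.

Lemma matop_bounded b : bounded_by eB b -> bounded_operator p (matop B).
Proof.
move=> Bb; split; first by move=> a x y _ _; exact: matop_lin.
exists (3 * b) => x hx; rewrite (lpnorm_nm hx) -lpnorm_ext matop_ext.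
rewrite -EFinM; apply/(bdE p1); apply: (op_bounded p1 (sec_bounded S Bb)).
by rewrite lp_ext.
Qed.

Lemma inv_le_invertible b K : bounded_by eB b -> inv_le p S eB K ->
  invertible_le p K (matop B).
Proof.
move=> Bb iB; have [K0 _ _] := iB.
have inj (x y : I -> C) : lp x -> lp y -> matop B x = matop B y -> x = y.
  move=> hx hy xy; apply: ext_inj; apply: (inv_le_inj p1 iB); rewrite ?lp_ext//.
  - exact: supp_ext.
  - exact: supp_ext.
  - by rewrite -!matop_ext xy.
(* The inverse is chosen pointwise, with a junk value off l^p; its linearity follows afterwards from
   injectivity. *)
have /choice[T hT] : forall y : I -> C, exists x, lp y ->
    [/\ lp x, matop B x = y & nm (ext x) <= K * nm (ext y)].
  move=> y; have [hy|nhy] := pselect (lp y); last by exists y.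
  have [|z [hz Sz zy zb]] := inv_le_solve iB _ (supp_ext y); first by rewrite lp_ext.
  exists (fun i => z (pos i)) => _; split.
  - by rewrite -lp_ext ext_restrict.
  - by apply: ext_inj; rewrite matop_ext ext_restrict.
  - by rewrite ext_restrict.
have [linB [c Bc]] := matop_bounded Bb.
have lpB (x : I -> C) : lp x -> lp (matop B x).
  move=> hx; rewrite -lp_ext matop_ext; apply: (op_bounded p1 (sec_bounded S Bb) _).1.
  by rewrite lp_ext.
have lpZD (a : C) (x y : I -> C) : lp x -> lp y -> lp (fun i => a * x i + y i).
  rewrite -!lp_ext => hx hy.
  have -> : ext (fun i => a * x i + y i) = (fun i => a * ext x i + ext y i).
    by apply/funext => i; rewrite /ext; case: ifP => // _; rewrite mulr0 addr0.
  exact: (nmD p1 (nmZ p1 a hx).1 hy).1.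
exists T.
  split.
  - exact: matop_bounded Bb.
  - split=> [a x y hx hy|].
      have [h1 h2 _] := hT _ hx; have [h3 h4 _] := hT _ hy.
      have [h5 h6 _] := hT _ (lpZD a _ _ hx hy).
      by apply: inj => //; [exact: lpZD|rewrite h6 linB// h2 h4].
    exists K => x hx; have [h1 h2 h3] := hT _ hx.
    by rewrite (lpnorm_nm hx) (lpnorm_nm h1) -EFinM lee_fin.
  - move=> x hx; have [h1 h2 _] := hT _ (lpB _ hx).
    exact: inj.
  - by move=> x hx; have [] := hT _ hx.
apply: ge_ereal_sup => _ [x /= x1 <-].
have hx : lp x by rewrite /Defs.lp/= (le_lt_trans x1)// ltry.
have [h1 h2 h3] := hT _ hx; rewrite (lpnorm_nm h1) lee_fin (le_trans h3)//.
by move: x1; rewrite (lpnorm_nm hx) lee_fin => x1; rewrite ler_piMr.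
Qed.

Lemma is_inverse_inv_le T K : is_inverse p (matop B) T -> 0 <= K ->
  (forall y, lp y -> nm (ext (T y)) <= K * nm (ext y)) -> inv_le p S eB K.
Proof.
move=> [[_ [c Bc]] [_ [d Td]] TB BT] K0 TK.
have lp_mul (f : (I -> C) -> I -> C) e (y : I -> C) : lp y ->
    (forall y, lp y -> (lpnorm p (f y) <= e%:E * lpnorm p y)%E) -> lp (f y).
  move=> hy /(_ y hy); rewrite (lpnorm_nm hy) -EFinM => h.
  by rewrite /Defs.lp/= (le_lt_trans h)// ltry.
have restr (z : int -> C) : lp z -> supp S z -> lp (fun i => z (pos i)).
  by move=> hz Sz; rewrite -lp_ext ext_restrict.
split=> // [x hx Sx|y hy Sy].
  have hx' := restr _ hx Sx.
  have := TK _ (lp_mul _ _ _ hx' Bc).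
  by rewrite TB// matop_ext ext_restrict.
have hy' := restr _ hy Sy; exists (ext (T (fun i => y (pos i)))); split.
- by rewrite lp_ext; exact: lp_mul Td.
- exact: supp_ext.
- by rewrite -matop_ext BT// ext_restrict.
Qed.

Lemma invertible_inv_le : invertible p (matop B) -> exists K, inv_le p S eB K.
Proof.
move=> [T TB]; have [_ [_ [d Td]] _ _] := TB.
exists (Num.max d 0); apply: (is_inverse_inv_le TB); first by rewrite le_max lexx orbT.
move=> y hy; have := Td y hy; rewrite (lpnorm_nm hy) -EFinM -lpnorm_ext.
move=> /(bdE p1)[_] /le_trans; apply; rewrite ler_wpM2r ?nm_ge0//.
by rewrite le_max lexx.
Qed.

(** [opnorm] controls the unit ball only; linearity of the inverse extends the estimate to y after
    division by its norm, and the case of norm 0 is treated apart. *)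
Lemma invertible_le_inv_le K : invertible_le p K (matop B) -> inv_le p S eB K.
Proof.
move=> [T TB TK]; have [_ [linT [d Td]] _ _] := TB.
have op1 (y : I -> C) : (lpnorm p y <= 1%:E)%E -> (lpnorm p (T y) <= K%:E)%E.
  by move=> y1; apply: le_trans TK; apply: ereal_sup_ubound; exists y.
have ext0 : ext (fun=> 0) = (fun=> 0).
  by apply/funext => k; rewrite /ext; case: ifP.
have lp0 : lp (fun _ : I => 0 : C).
  rewrite -lp_ext ext0; exact: (nm0 p1).1.
have nm00 : nm (ext (fun=> 0)) = 0.
  by rewrite ext0 (nm0 p1).2.
have K0 : 0 <= K.
  rewrite -lee_fin (le_trans (lpnorm_ge0 p1 (g 0) (T (fun=> 0))))// op1//.
  by rewrite (lpnorm_nm lp0) lee_fin nm00.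
apply: (is_inverse_inv_le TB) => // y hy.
have T0 : T (fun=> 0) = (fun=> 0).
  have := linT 1 _ _ lp0 lp0.
  rewrite (_ : (fun i => 1 * 0 + 0) = (fun=> 0)); last by apply/funext => i; rewrite mulr0 addr0.
  move=> h; apply/funext => i; have := congr1 (@^~ i) h => /= /eqP.
  by rewrite mul1r -subr_eq0 opprD addrA subrr add0r oppr_eq0 => /eqP.
have lpZ (a : C) (z : I -> C) : lp z ->
    lp (fun i => a * z i) /\ nm (ext (fun i => a * z i)) <= cabs a * nm (ext z).
  rewrite -!lp_ext; have -> : ext (fun i => a * z i) = (fun i => a * ext z i).
    by apply/funext => i; rewrite /ext; case: ifP => // _; rewrite mulr0.
  exact: nmZ.
have TZ (a : C) (z : I -> C) : lp z -> T (fun i => a * z i) = (fun i => a * T z i).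
  move=> hz; have := linT a z _ hz lp0; rewrite T0.
  have -> : (fun i => a * z i + 0) = (fun i => a * z i).
    by apply/funext => i; rewrite addr0.
  by move=> ->; apply/funext => i; rewrite addr0.
have hTy : lp (T y).
  by have := Td y hy; rewrite (lpnorm_nm hy) -EFinM => h; rewrite /Defs.lp/= (le_lt_trans h)// ltry.
have [y0|y0] := leP (nm (ext y)) 0.
  have h : ext y = (fun=> 0) by apply: (nm_eq0 p1) => //; rewrite lp_ext.
  have -> : y = (fun=> 0).
    by apply/funext => i; rewrite -ext_pos h.
  by rewrite T0 nm00 mulr0.
set t := nm (ext y) in y0 *.
have [h1 h2] := lpZ (real_complex R t^-1) y hy.
have ct (r : R) : 0 < r -> cabs (real_complex R r) = r by move=> r0; rewrite cabs_real gtr0_norm.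
have : (lpnorm p (T (fun i => (real_complex R t^-1 * y i)%R)) <= K%:E)%E.
  apply: op1; rewrite (lpnorm_nm h1) lee_fin (le_trans h2)// ct ?invr_gt0//.
  by rewrite mulVf ?gt_eqF.
rewrite TZ// -lpnorm_ext => /(bdE p1)[h3 h4]; move: h3; rewrite lp_ext => h3.
have [_] := lpZ (real_complex R t) _ h3.
rewrite (_ : (fun i => _) = T y); last first.
  by apply/funext => i; rewrite mulrA -rmorphM divff ?gt_eqF// rmorph1 mul1r.
by move=> /le_trans; apply; rewrite ct// mulrC ler_wpM2r// ltW.
Qed.

End Transfer.

(** * The case of bi-infinite matrices *)

Section IntegerMatrices.
Variable R : realType.
Local Notation C := (complex R).
Variables (U V W : set C) (A : int -> int -> C).
Hypothesis MA : Mbi U V W A.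

Let predTP (i : int) : predT i := isT.
Let idK : cancel (@id int) id := fun=> erefl.
Let idK' k (_ : predT k) : @id int (id k) = k := erefl.

Lemma matop_op x : matop A x = op A x.
Proof. exact: (matop_ext predTP idK idK' 0 0 0 MA x). Qed.

Variable p : \bar R.
Hypothesis p1 : (1 <= p)%E.

Lemma lpnorm_int (x : int -> C) : lp p x -> lpnorm p x = (nm p x)%:E.
Proof. exact: (lpnorm_nm predTP idK idK' p1). Qed.

Lemma matop_bounded_int b : bounded_by A b -> bounded_operator p (matop A).
Proof. exact: (matop_bounded predTP idK idK' (u := 0) (v := 0) (w := 0) MA p1). Qed.

Lemma inv_le_invertible_int b K : bounded_by A b -> inv_le p predT A K ->
  invertible_le p K (matop A).
Proof. exact: (inv_le_invertible predTP idK idK' (u := 0) (v := 0) (w := 0) MA p1). Qed.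

Lemma invertible_inv_le_int : invertible p (matop A) -> exists K, inv_le p predT A K.
Proof. exact: (invertible_inv_le predTP idK idK' 0 0 0 MA p1). Qed.

Lemma invertible_le_inv_le_int K : invertible_le p K (matop A) -> inv_le p predT A K.
Proof. exact: (invertible_le_inv_le predTP idK idK' 0 0 0 MA p1). Qed.

End IntegerMatrices.

(** * The finite section method *)

Section FiniteSectionMethod.
Variables (R : realType) (p : \bar R).
Hypothesis p1 : (1 <= p)%E.
Local Notation C := (complex R).
Local Notation nm := (nm p).
Local Notation lp := (lp p).
Variables (U V W : set C) (A : int -> int -> C) (b : R).
Hypotheses (MA : Mbi U V W A) (Ab : bounded_by A b).

Definition window (n : nat) : pred int := fun i => - n%:Z <= i <= n%:Z.

Lemma Pcut_window n (x : int -> C) i : Pcut (- n%:Z) n%:Z x i = if window n i then x i else 0.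
Proof. by []. Qed.

Lemma supp_Pcut n (x : int -> C) : supp (window n) (Pcut (- n%:Z) n%:Z x).
Proof. by move=> i /negbTE wi; rewrite Pcut_window wi. Qed.

Lemma Pcut_id n (x : int -> C) : supp (window n) x -> Pcut (- n%:Z) n%:Z x = x.
Proof.
move=> Sx; apply/funext => i; rewrite Pcut_window; case: ifPn => // wi.
by rewrite Sx.
Qed.

Lemma Pcut_matop n (x : int -> C) : supp (window n) x ->
  Pcut (- n%:Z) n%:Z (matop A (Pcut (- n%:Z) n%:Z x)) = op (sec (window n) A) x.
Proof.
move=> Sx; apply/funext => i; rewrite Pcut_window Pcut_id// (matop_op MA) op_sec//.
Qed.

Lemma lp_Pcut n (x : int -> C) : lp x ->
  lp (Pcut (- n%:Z) n%:Z x) /\ nm (Pcut (- n%:Z) n%:Z x) <= nm x.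
Proof. exact: (nm_restrict p1 (window n)). Qed.

(** Leads back from ultrafilter limits to ordinary ones: if convergence failed, some choice of
    indices tending to infinity would keep z at a positive distance from l. *)
Lemma cvg_tends (M : nat) (z : nat -> C) l :
  (forall k : nat -> nat, (forall N, (M + N <= k N)%N) -> tends (z \o k) l) ->
  (z : nat -> C^o) @ \oo --> (l : C^o).
Proof.
move=> h; apply/cvgrPdist_lt => e e0.
have [r r0 ->] : exists2 r : R, 0 < r & e = real_complex R r.
  move: e0; case: e => a c; rewrite ltcE/= => /andP[/eqP -> a0].
  by exists a.
apply: contrapT => nn.
have /choice[k kP] : forall N : nat, exists n, (M + N <= n)%N /\ r <= cabs (l - z n).
  move=> N; apply: contrapT => nk; apply: nn; exists (M + N)%N => // n /= Nn.
  rewrite -[`|_|]/(real_complex R (cabs (l - z n))) ltcR ltNge; apply/negP => rn.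
  by apply: nk; exists n.
have [n /= hn] := filter_ex (h k (fun N => (kP N).1) r r0).
by have [_] := kP n; rewrite cabsB leNgt hn.
Qed.

(** The solutions of the finite systems are bounded. Any componentwise limit of them solves the full
    equation, whose solution is unique. *)
Lemma fsm_of_inv_le K0 K N : inv_le p predT A K0 ->
  (forall n, (N <= n)%N -> inv_le p (window n) A K) ->
  full_fsm_applicable p (matop A).
Proof.
move=> iA iN; split.
  have [T TA _] := inv_le_invertible_int MA p1 Ab iA.
  by exists T.
move=> y hy.
have /choice[xs xsP] : forall n, exists x, (N <= n)%N -> [/\ lp x, supp (window n) x,
    op (sec (window n) A) x = Pcut (- n%:Z) n%:Z y & nm x <= K * nm y].
  move=> n; have [Nn|] := leqP N n; last by exists (fun=> 0).
  have [h1 h2] := lp_Pcut n hy.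
  have [x [hx Sx xy xb]] := inv_le_solve (iN _ Nn) h1 (@supp_Pcut n y).
  exists x => _; split=> //; rewrite (le_trans xb)// ler_wpM2l//.
  by have [] := iN _ Nn.
exists N, xs; split.
- move=> n Nn; have [hx Sx xy xb] := xsP n Nn; split.
  + by exists (xs n) => //; exact: Pcut_id.
  + by rewrite Pcut_matop.
  + move=> _ [z _ <-]; set z' := Pcut _ _ z.
    have Sz : supp (window n) z' := @supp_Pcut n z.
    rewrite Pcut_matop// -xy; apply: (inv_le_inj p1 (iN _ Nn)) => //.
    apply: (@lp_fin _ _ p1 n) => i ni; apply: Sz; rewrite /window.
    by clear - ni; lia.
- exists (K * nm y) => n Nn; have [hx Sx xy xb] := xsP n Nn.
  by rewrite (lpnorm_int p1)// lee_fin.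
move=> x hx xy i; apply: (@cvg_tends N (xs ^~ i)) => k kN.
have kb n : lp (xs (k n)) /\ nm (xs (k n)) <= K * nm y.
  by have [] := xsP (k n) (leq_trans (leq_addr _ _) (kN _)).
have [l [hl lb lim]] := nm_compact p1 kb.
suff <- : l = x by exact: lim.
apply: (inv_le_inj p1 iA) => //; rewrite sec_predT -[RHS](matop_op MA) xy.
apply/funext => j.
have h1 : tends (fun n => op A (xs (k n)) j) (op A l j).
  by apply: tends_op lim => k'; exact: tends_cst.
apply: (tends_uniq h1); apply: tends_near (tends_cst _).
apply: (@ultra_nat_ge _ `|j|%N) => n /= jn.
have kn := kN n; have Nk : (N <= k n)%N by clear - kn; lia.
have wj : window (k n) j by rewrite /window; clear - kn jn; lia.
have [_ h3 h4 _] := xsP _ Nk.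
by have := op_sec A j h3; rewrite wj h4 Pcut_window wj.
Qed.

(** A uniform boundedness argument: [F m] collects the right-hand sides whose finite systems have
    solutions of norm at most m for all n >= m. It is closed by compactness, and these sets cover
    l^p by applicability. *)
Lemma inv_le_of_fsm : full_fsm_applicable p (matop A) ->
  exists (N : nat) (K : R), forall n, (N <= n)%N -> inv_le p (window n) A K.
Proof.
move=> [_ fsm].
pose F (m : nat) (y : int -> C) := forall n, (m <= n)%N -> exists x,
  [/\ lp x, supp (window n) x, op (sec (window n) A) x = Pcut (- n%:Z) n%:Z y &
      nm x <= m%:R].
have [m [r [r0 ball]]] : exists m r, 0 < r /\ forall y, lp y -> nm y <= r -> F m y.
  apply: (baire_symmetric p1).
  - move=> m y hy cl n mn.
    have /choice[ys ysP] : forall k : nat, exists z,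
        [/\ lp z, F m z & nm (fun i => z i - y i) <= k.+1%:R^-1].
      by move=> k; apply: cl; rewrite invr_gt0.
    have /choice[xs xsP] : forall k, exists x, [/\ lp x, supp (window n) x,
        op (sec (window n) A) x = Pcut (- n%:Z) n%:Z (ys k) & nm x <= m%:R].
      by move=> k; have [_ + _] := ysP k; apply.
    have xb k : lp (xs k) /\ nm (xs k) <= m%:R by have [] := xsP k.
    have [x [hx xm lim]] := nm_compact p1 xb.
    have ylim i : tends (fun k => ys k i) (y i).
      move=> e e0; have [N hN] := @lt_epsilon R 1 e ler01 e0.
      apply: (@ultra_nat_ge _ N) => k Nk /=; have [h1 _ h2] := ysP k.
      have [h3 _] := nmB p1 h1 hy.
      rewrite (le_lt_trans (cabs_le_nm p1 i h3))// (le_lt_trans h2)//.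
      by rewrite (le_lt_trans _ hN)// div1r lef_pV2 ?posrE// ler_nat.
    exists x; split=> // [i wi|].
      apply: tends_uniq (lim i) _; apply: tends_near (tends_cst _).
      by apply: filterE => k /=; have [_ h _ _] := xsP k; exact: h.
    apply/funext => i.
    have h1 : tends (fun k => op (sec (window n) A) (xs k) i) (op (sec (window n) A) x i).
      by apply: tends_op lim => k'; exact: tends_cst.
    apply: (tends_uniq h1).
    apply: (@tends_near _ _ (fun k => Pcut (- n%:Z) n%:Z (ys k) i)).
      by apply: filterE => k /=; have [_ _ -> _] := xsP k.
    by rewrite /Pcut; case: ifP => _; [exact: ylim|exact: tends_cst].
  - move=> m y z hy hz Fy Fz n mn; have [x [h1 h2 h3 h4]] := Fy n mn.
    have [x' [h1' h2' h3' h4']] := Fz n mn.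
    have [h5 h6] := nmB p1 h1 h1'; have [h7 h8] := nmZ p1 (real_complex R 2^-1) h5.
    exists (fun i => real_complex R 2^-1 * (x i - x' i)); split=> //.
    + by move=> i wi; rewrite h2// h2'// subrr mulr0.
    + rewrite opZ opB h3 h3'; apply/funext => i; rewrite /Pcut.
      by case: ifP => // _; rewrite subrr mulr0.
    + rewrite (le_trans h8)// cabs_real ger0_norm ?invr_ge0//; lra.
  - move=> y hy; have [n0 [xs [h1 [c hc] _]]] := fsm y hy.
    (* One number has to bound both the starting index and the solutions, whence the sum. *)
    pose t := Num.truncn (Num.max c 0); exists (n0 + t + 1)%N => n hn.
    have n0n : (n0 <= n)%N by clear - hn; lia.
    have [[z _ zx] h3 _] := h1 n n0n.
    have Sx : supp (window n) (xs n) by rewrite -zx; exact: supp_Pcut.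
    have /(bdE p1)[h4 h5] := hc n n0n.
    exists (xs n); split=> //; first by rewrite -h3 Pcut_matop.
    rewrite (le_trans h5)// (@le_trans _ _ (Num.max c 0))//; first by rewrite le_max lexx.
    by rewrite (le_trans (ltW (truncnS_gt _)))// ler_nat -/t addn1 ltnS leq_addl.
(* Unique solvability for the right-hand side 0 gives injectivity from an index on that does not
   depend on y. *)
have [n0 [xs [inj _ _]]] := fsm _ (nm0 p1).1.
exists (m + n0)%N, (m%:R / r) => n hn.
have mn : (m <= n)%N by clear - hn; lia.
have n0n : (n0 <= n)%N by clear - hn; lia.
have ker z : supp (window n) z -> op (sec (window n) A) z = (fun=> 0) -> z = (fun=> 0).
  move=> Sz z0; have P0 : Pcut (- n%:Z) n%:Z (fun=> 0 : C) = (fun=> 0).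
    by apply/funext => i; rewrite /Pcut; case: ifP.
  have [_ _ uniqx] := inj n n0n.
  have -> : z = xs n.
    by apply: uniqx; [exists z => //; exact: Pcut_id|rewrite Pcut_matop// z0 P0].
  apply/esym; apply: uniqx; first by exists (fun=> 0).
  rewrite Pcut_matop ?op0 ?P0//; by move=> ? _.
have solve y : lp y -> supp (window n) y -> exists x, [/\ lp x, supp (window n) x,
    op (sec (window n) A) x = y & nm x <= m%:R / r * nm y].
  apply: (solve_scale p1 r0) => {}y hy Sy yr; have := ball _ hy yr n mn.
  by rewrite Pcut_id.
split; first by rewrite divr_ge0// ltW.
  move=> x hx Sx; have [hy _] := op_bounded p1 (sec_bounded (window n) Ab) hx.
  have [z [hz Sz zx zb]] := solve _ hy (@supp_op_sec R (window n) A x).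
  have := ker (fun i => x i - z i); rewrite opB zx => h.
  have {}h : (fun i => x i - z i) = (fun=> 0).
    by apply: h; [move=> i wi; rewrite Sx// Sz// subrr|apply/funext => i; rewrite subrr].
  have xz : x = z.
    by apply/funext => i; apply/eqP; rewrite -subr_eq0 (congr1 (@^~ i) h).
  by rewrite {1}xz.
by move=> y hy Sy; have [x [? ? ? _]] := solve y hy Sy; exists x.
Qed.

End FiniteSectionMethod.

(** * Pseudoergodic matrices *)

Section LeftKernel.
Variable R : realType.
Local Notation C := (complex R).

(** There are n + 1 vectors in a space of dimension n; dividing a relation by its largest
    coefficient bounds all others by 1. *)
Lemma normalized_relation (n : nat) (c : 'I_n.+1 -> 'I_n -> C) :
  exists (d : 'I_n.+1 -> C) (s0 : 'I_n.+1),
    [/\ d s0 = 1, forall s, cabs (d s) <= 1 & forall k, \sum_s d s * c s k = 0].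
Proof.
pose M := \matrix_(s, k) c s k.
have : kermx M != 0.
  by rewrite kermx_eq0 /row_free neq_ltn (leq_ltn_trans (rank_leq_col M)).
case/rowV0Pn => v /sub_kermxP vM v0.
have [s1 vs1] : exists s1, v 0 s1 != 0.
  by apply/rV0Pn.
pose s0 := [arg max_(s > s1) cabs (v 0 s)]%O.
have s0max s : cabs (v 0 s) <= cabs (v 0 s0).
  by rewrite /s0; case: arg_maxP => // i _; apply.
have vs0 : v 0 s0 != 0.
  rewrite -cabs_eq0 gt_eqF// (lt_le_trans _ (s0max s1))//.
  by rewrite lt_def cabs_eq0 vs1 cabs_ge0.
exists (fun s => v 0 s / v 0 s0), s0; split=> [|s|k].
- by rewrite divff.
- rewrite normcM normcV ler_pdivrMr ?mul1r//.
  by rewrite lt_def cabs_eq0 vs0 cabs_ge0.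
- have /rowP/(_ k) := vM; rewrite !mxE => h.
  transitivity ((v 0 s0)^-1 * \sum_j v 0 j * M j k); last by rewrite h mulr0.
  rewrite mulr_sumr; apply: eq_bigr => s _.
  by rewrite mxE mulrAC mulrC.
Qed.

End LeftKernel.

Section Pseudoergodic.
Variable R : realType.
Local Notation C := (complex R).
Variables (U V W : set C).
Implicit Types (A B : int -> int -> C).

Definition matches A B (L : nat) (e : R) (k : int) :=
  forall i j : int, `|i| <= L%:Z -> cabs (A (i + k) (j + k) - B i j) < e.

(** Membership in M(U,V,W) is a shift-invariant condition on single rows, so new members can be
    assembled from rows of others. *)
Lemma Mbi_rows B : (forall i, exists B' k, Mbi U V W B' /\
  forall j, B i j = B' (i + k) (j + k)) -> Mbi U V W B.
Proof.
move=> h; split=> [i j ij|i|i j ij|i j ij].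
- have [B' [k [[MU _ _ _] ->]]] := h i; apply: MU; rewrite /= ij; lia.
- by have [B' [k [[_ MV _ _] ->]]] := h i; apply: MV.
- have [B' [k [[_ _ MW _] ->]]] := h i; apply: MW; rewrite /= ij; lia.
- have [B' [k [[_ _ _ M0] ->]]] := h i; apply: M0; rewrite /=; lia.
Qed.

Lemma norm3_ge (z : C * C * C) :
  [/\ cabs z.1.1 <= norm3 z, cabs z.1.2 <= norm3 z & cabs z.2 <= norm3 z].
Proof.
rewrite /norm3; have := sqr_ge0 (cabs z.1.1); have := sqr_ge0 (cabs z.1.2).
have := sqr_ge0 (cabs z.2); set a := cabs z.1.1; set b := cabs z.1.2; set c := cabs z.2.
move=> c2 b2 a2.
have h (t : R) : 0 <= t -> t ^+ 2 <= a ^+ 2 + b ^+ 2 + c ^+ 2 ->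
    t <= Num.sqrt (a ^+ 2 + b ^+ 2 + c ^+ 2).
  by move=> t0 ht; rewrite -(ger0_norm t0) -sqrtr_sqr ler_wsqrtr.
by split; apply: h; rewrite ?cabs_ge0//; lra.
Qed.

Lemma PsiE_matches A B (L : nat) (e : R) : PsiE U V W A -> Mbi U V W B -> 0 < e ->
  exists k, matches A B L e k.
Proof.
move=> [[_ _ _ A0] psi] [BU BV BW B0] e0.
pose b (s : 'I_(L + L).+1) : C * C * C :=
  let i := s%:Z - L%:Z in (B i (i - 1), B i i, B i (i + 1)).
have [|k hk] := psi e e0 (L + L).+1 b.
  move=> s; split; [split|] => /=; [apply: BU => /=; lia|exact: BV|exact: BW].
(* The word consists of the rows -L, ..., L of B, and pseudoergodicity places its first letter at k
   + 1. *)
exists (k + L%:Z + 1) => i j iL.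
have sL : (`|(i + L%:Z)%R| < (L + L).+1)%N by clear - iL; lia.
have := hk (Ordinal sL); rewrite /b /=.
have -> : k + (`|(i + L%:Z)%R|%N).+1 = i + (k + L%:Z + 1) by clear - iL; lia.
have -> : `|(i + L%:Z)%R|%N%:Z - L%:Z = i by clear - iL; lia.
set K := k + L%:Z + 1.
set z := (_ - _) => hz; have [h1 h2 h3] := norm3_ge z.
have [->|[->|[->|ij]]] : j = i - 1 \/ j = i \/ j = i + 1 \/ 1 < `|i - j| by clear; lia.
- by rewrite (addrAC i); exact: le_lt_trans h1 hz.
- exact: le_lt_trans h2 hz.
- by rewrite (addrAC i); exact: le_lt_trans h3 hz.
- by rewrite A0 ?B0 ?subrr ?normc0//=; clear - ij; lia.
Qed.

(** The rows -L, ..., L of B are repeated periodically by means of the folding [f]; one long match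
    with the result contains m disjoint copies of the block. *)
Lemma PsiE_matches_disjoint A B (L : nat) (e : R) (m : nat) :
  PsiE U V W A -> Mbi U V W B -> 0 < e ->
  exists k : int, forall s : nat, (s < m)%N ->
    matches A B L e (k + s%:Z * (2 * L%:Z + 1)).
Proof.
move=> PA MB e0; pose D : int := 2 * L%:Z + 1.
pose f (i : int) : int := modz (i + L%:Z) D - L%:Z.
pose B' (i j : int) := B (f i) (f i + (j - i)).
have MB' : Mbi U V W B'.
  apply: Mbi_rows => i; exists B, (f i - i); split=> // j; rewrite /B'.
  by congr B; ring.
have [k hk] := PsiE_matches (m * (2 * L + 1) + L)%N PA MB' e0.
exists k => s sm i j iL.
have fE : f (i + s%:Z * D) = i.
  rewrite /f (_ : i + s%:Z * D + L%:Z = s%:Z * D + (i + L%:Z)); last by ring.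
  rewrite modzMDl modz_small ?addrK//.
  by rewrite /D; clear - iL; lia.
have := hk (i + s%:Z * D) (j + s%:Z * D).
have -> : B' (i + s%:Z * D) (j + s%:Z * D) = B i j.
  by rewrite /B' fE; congr B; ring.
rewrite -!addrA ![_ * D + k]addrC; apply.
rewrite /D; clear - iL sm; have : (s%:Z * (2 * L%:Z + 1) <= m%:Z * (2 * L%:Z + 1)).
  by rewrite ler_wpM2r//; lia.
by nia.
Qed.

Definition recurs_right A := forall B (L : nat) (e : R) (N : nat),
  Mbi U V W B -> 0 < e -> exists k, N%:Z <= k /\ matches A B L e k.

Definition recurs_left A := forall B (L : nat) (e : R) (N : nat),
  Mbi U V W B -> 0 < e -> exists k, k <= - N%:Z /\ matches A B L e k.

(* If B1 does not recur on the right and B2 does not recur on the left, then a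
   block of B2 followed far to the right by a block of B1 does not occur. *)
Lemma PsiE_recurs A : PsiE U V W A -> recurs_right A \/ recurs_left A.
Proof.
move=> PA; apply: contrapT => /not_orP[nR nL].
have [B1 [L1 [e1 [N1 [M1 e10 h1]]]]] : exists B L e (N : nat),
    [/\ Mbi U V W B, 0 < e & forall k, matches A B L e k -> k < N%:Z].
  apply: contrapT => n; apply: nR => B L e N MB e0; apply: contrapT => n'.
  apply: n; exists B, L, e, N; split=> // k mk; rewrite ltNge; apply/negP => Nk.
  by apply: n'; exists k.
have [B2 [L2 [e2 [N2 [M2 e20 h2]]]]] : exists B L e (N : nat),
    [/\ Mbi U V W B, 0 < e & forall k, matches A B L e k -> - N%:Z < k].
  apply: contrapT => n; apply: nL => B L e N MB e0; apply: contrapT => n'.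
  apply: n; exists B, L, e, N; split=> // k mk; rewrite ltNge; apply/negP => Nk.
  by apply: n'; exists k.
(* The part L1 + L2 + 1 separates the two blocks. A match at k yields - N2 < k and k + T < N1,
   impossible because T >= N1 + N2. *)
pose T : nat := (N1 + N2 + L1 + L2 + 1)%N.
pose B (i j : int) := if i <= L2%:Z then B2 i j else B1 (i - T%:Z) (j - T%:Z).
have MB : Mbi U V W B.
  apply: Mbi_rows => i; have [iL|iL] := boolP (i <= L2%:Z).
    by exists B2, 0; split=> // j; rewrite /B iL !addr0.
  by exists B1, (- T%:Z); split=> // j; rewrite /B (negbTE iL).
have e0 : 0 < Num.min e1 e2 by rewrite lt_min e10.
have [k hk] := PsiE_matches (T + L1 + L2)%N PA MB e0.
have k2 : - N2%:Z < k.
  apply: h2 => i j iL; have := hk i j; rewrite /B ifT; last by clear - iL; lia.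
  by rewrite lt_min => /(_ _)/andP[]//; clear - iL; lia.
have k1 : k + T%:Z < N1%:Z.
  apply: h1 => i j iL; have := hk (i + T%:Z) (j + T%:Z).
  rewrite /B ifF ?addrK; last by rewrite /T; clear - iL; lia.
  rewrite -!addrA ![T%:Z + k]addrC lt_min => /(_ _)/andP[]//.
  by rewrite /T; clear - iL; lia.
by move: k1 k2; rewrite /T; clear; lia.
Qed.

Variable p : \bar R.
Hypothesis p1 : (1 <= p)%E.
Local Notation nm := (nm p).
Local Notation lp := (lp p).
Variable b : R.
Hypothesis Mb : forall B, Mbi U V W B -> bounded_by B b.

Lemma inv_le_PsiE A B K : PsiE U V W A -> inv_le p predT A K -> Mbi U V W B ->
  inv_le p predT B K.
Proof.
move=> PA iA MB; have [K0 _ _] := iA.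
apply: (inv_le_limit p1 (F := fun S B => inv_le p S B K) (Mb MB) K0) => // L e e0.
have [k hk] := PsiE_matches L PA MB e0.
have [MA _] := PA.
exists predT, (fun i j => A (i + k) (j + k)); split.
  exact: (inv_le_shift p1 (S := predT) k (Mb MA) iA).
by move=> i j iL jL; split=> //; exact: hk.
Qed.

(** Around a match at k > 0 the window of radius k, seen from k, runs from - 2 k to 0: its right end
    stays at 0, while the left end leaves every box. *)
Lemma inv_le_halfline_neg A K N : Mbi U V W A -> recurs_right A ->
  (forall n, (N <= n)%N -> inv_le p (window n) A K) ->
  forall B, Mbi U V W B -> inv_le p (fun i => i <= 0) B K.
Proof.
move=> MA rA iA B MB; have [K0 _ _] := iA N (leqnn _).
apply: (inv_le_limit p1 (F := fun S B => inv_le p S B K) (Mb MB) K0) => // L e e0.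
have [k [kN hk]] := rA B L e (N + L)%N MB e0.
exists (fun i => window `|k|%N (i + k)), (fun i j => A (i + k) (j + k)); split.
  by apply: (inv_le_shift p1 (S := window `|k|%N) k (Mb MA)); apply: iA; clear - kN; lia.
move=> i j iL jL; split; last exact: hk.
by rewrite /window; clear - kN iL; lia.
Qed.

Lemma inv_le_halfline_pos A K N : Mbi U V W A -> recurs_left A ->
  (forall n, (N <= n)%N -> inv_le p (window n) A K) ->
  forall B, Mbi U V W B -> inv_le p (fun i => 0 <= i) B K.
Proof.
move=> MA rA iA B MB; have [K0 _ _] := iA N (leqnn _).
apply: (inv_le_limit p1 (F := fun S B => inv_le p S B K) (Mb MB) K0) => // L e e0.
have [k [kN hk]] := rA B L e (N + L)%N MB e0.
exists (fun i => window `|k|%N (i + k)), (fun i j => A (i + k) (j + k)); split.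
  by apply: (inv_le_shift p1 (S := window `|k|%N) k (Mb MA)); apply: iA; clear - kN; lia.
move=> i j iL jL; split; last exact: hk.
by rewrite /window; clear - kN iL; lia.
Qed.

(* Reflection combined with transposition maps M(U, V, W) to itself and exchanges
   the two half lines. *)
Lemma lower_bound_opposite (S : pred int) K : 0 <= K ->
  (forall B, Mbi U V W B -> inv_le p S B K) ->
  exists K', 0 <= K' /\
    forall B, Mbi U V W B -> lower_bound p (fun i => S (- i)) B K'.
Proof.
move=> K0 iS; have [K' [K'0 hK']] := lower_bound_transpose p1 b K0.
exists K'; split=> // B MB.
pose B' (i j : int) := B (- j) (- i).
have MB' : Mbi U V W B'.
  have [BU BV BW B0] := MB.
  split=> [i j ij|i|i j ij|i j ij]; rewrite /B'.
  - by apply: BU => /=; move: ij => /=; clear; lia.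
  - exact: BV.
  - by apply: BW => /=; move: ij => /=; clear; lia.
  - by apply: B0 => /=; move: ij => /=; clear; lia.
have h := hK' S B' (Mb MB') (iS _ MB').
have tb : bounded_by (trmat B') b by move=> i j; exact: (Mb MB').
have := lower_bound_reflect p1 tb K'0 h.
rewrite (_ : (fun i j : int => trmat B' (- i) (- j)) = B)//.
by apply/funext => i; apply/funext => j; rewrite /trmat /B' !opprK.
Qed.

Lemma lower_bound_translate (S : pred int) K k B : 0 <= K ->
  (forall B, Mbi U V W B -> lower_bound p S B K) -> Mbi U V W B ->
  lower_bound p (fun i => S (i + k)) B K.
Proof.
move=> K0 hS MB; pose B' (i j : int) := B (i - k) (j - k).
have MB' : Mbi U V W B' by apply: Mbi_rows => i; exists B, (- k).
have := lower_bound_shift p1 (k := k) (Mb MB') K0 (hS _ MB').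
rewrite (_ : (fun i j : int => B' (i + k) (j + k)) = B)//.
by apply/funext => i; apply/funext => j; rewrite /B' !addrK.
Qed.

Lemma inv_le_window K : 0 <= K ->
  (forall B, Mbi U V W B -> lower_bound p (fun i => 0 <= i) B K) ->
  (forall B, Mbi U V W B -> lower_bound p (fun i => i <= 0) B K) ->
  exists N : nat, forall B n, (N <= n)%N -> Mbi U V W B ->
    inv_le p (window n) B (4 * K).
Proof.
move=> K0 hp hn; exists (Num.truncn (12 * b * K)).+1 => B n Nn MB.
have n0 : (0 < n)%N by apply: leq_trans Nn.
apply: (inv_le_fin p1 (L := n)) => [i||].
- by rewrite /window; clear; lia.
- by rewrite mulr_ge0.
apply: (lower_bound_cut p1 (Mb MB) K0).
- by clear - n0; lia.
- rewrite (_ : n%:Z - - n%:Z = (n + n)%N%:Z); last by clear; lia.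
  rewrite (le_trans (ltW (truncnS_gt _)))// -[leRHS]/((n + n)%:R) ler_nat.
  by rewrite (leq_trans Nn)// leq_addr.
- have := lower_bound_translate (k := n%:Z) K0 hp MB.
  rewrite (_ : (fun i : int => 0 <= i + n%:Z) = (fun i : int => - n%:Z <= i))//.
  by apply/funext => i; clear; lia.
- have := lower_bound_translate (k := - n%:Z) K0 hn MB.
  rewrite (_ : (fun i : int => i - n%:Z <= 0) = (fun i : int => i <= n%:Z))//.
  by apply/funext => i; clear; lia.
Qed.

(** One half line is reached as a limit of finite sections of A. Transposition yields a mere lower
    bound on the other, which suffices because finite windows are onto by dimension. *)
Lemma fsm_PsiE A B : PsiE U V W A -> full_fsm_applicable p (matop A) ->
  Mbi U V W B -> full_fsm_applicable p (matop B).
Proof.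
move=> PA fA MB; have [MA _] := PA.
have [K0 iA] := invertible_inv_le_int MA p1 fA.1.
have [N [K iN]] := inv_le_of_fsm p1 MA (Mb MA) fA.
have [K00 _ _] := iN N (leqnn _).
have [K' [K'0 hp hn]] : exists K', [/\ 0 <= K',
    forall B, Mbi U V W B -> lower_bound p (fun i => 0 <= i) B K' &
    forall B, Mbi U V W B -> lower_bound p (fun i => i <= 0) B K'].
  have mono (S : pred int) (K1 K2 : R) B' : K1 <= K2 -> lower_bound p S B' K1 ->
      lower_bound p S B' K2.
    by move=> K12 h x hx Sx; rewrite (le_trans (h x hx Sx))// ler_wpM2r// nm_ge0.
  have [rA|rA] := PsiE_recurs PA.
    have iS := inv_le_halfline_neg MA rA iN.
    have [K' [K'0 h]] := lower_bound_opposite K00 iS.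
    exists (Num.max K K'); split=> [|B' MB'|B' MB'].
    - by rewrite le_max K00.
    - apply: (mono _ K'); first by rewrite le_max lexx orbT.
      have := h B' MB'; rewrite (_ : (fun i : int => - i <= 0) = (fun i : int => 0 <= i))//.
      by apply/funext => i; rewrite oppr_le0.
    - by apply: (mono _ K); [rewrite le_max lexx|have [] := iS _ MB'].
  have iS := inv_le_halfline_pos MA rA iN.
  have [K' [K'0 h]] := lower_bound_opposite K00 iS.
  exists (Num.max K K'); split=> [|B' MB'|B' MB'].
  - by rewrite le_max K00.
  - by apply: (mono _ K); [rewrite le_max lexx|have [] := iS _ MB'].
  - apply: (mono _ K'); first by rewrite le_max lexx orbT.
    have := h B' MB'; rewrite (_ : (fun i : int => 0 <= - i) = (fun i : int => i <= 0))//.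
    by apply/funext => i; rewrite oppr_ge0.
have [M hM] := inv_le_window K'0 hp hn.
apply: (fsm_of_inv_le p1 MB (Mb MB) (inv_le_PsiE PA iA MB) (N := M) (K := 4 * K')).
by move=> n Mn; exact: hM.
Qed.

End Pseudoergodic.

(** * Fredholm operators with pseudoergodic matrices *)

Section Fredholm.
Variables (R : realType) (p : \bar R).
Hypothesis p1 : (1 <= p)%E.
Local Notation C := (complex R).
Local Notation nm := (nm p).
Local Notation lp := (lp p).
Variables (U V W : set C) (A : int -> int -> C) (b : R).
Hypotheses (PA : PsiE U V W A) (Ab : bounded_by A b).

(** An open mapping theorem for the map sending (x, c) to A x plus the combination of the vectors
    [e k]. The sets [F m] also bound the coefficients, so that these have limits. *)
Lemma fredholm_ball : fredholm p (matop A) ->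
  exists (n : nat) (e : 'I_n -> int -> C) (M r : R), 0 < r /\
    forall y, lp y -> nm y <= r -> exists x (c : 'I_n -> C),
      [/\ lp x, nm x <= M & y = (fun i => op A x i + \sum_k c k * e k i)].
Proof.
have [MA _] := PA; move=> [_ _ [n [e [he cover]]]].
pose F (m : nat) (y : int -> C) := exists x (c : 'I_n -> C),
  [/\ lp x, nm x <= m%:R, forall k, cabs (c k) <= m%:R &
      y = (fun i => op A x i + \sum_k c k * e k i)].
have [m [r [r0 ball]]] : exists m r, 0 < r /\ forall y, lp y -> nm y <= r -> F m y.
  apply: (baire_symmetric p1).
  - move=> m y hy cl.
    have /choice[ys ysP] : forall k : nat, exists z,
        [/\ lp z, F m z & nm (fun i => z i - y i) <= k.+1%:R^-1].
      by move=> k; apply: cl; rewrite invr_gt0.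
    have /choice[xc xcP] : forall k, exists xc : (int -> C) * ('I_n -> C),
        [/\ lp xc.1, nm xc.1 <= m%:R, forall l, cabs (xc.2 l) <= m%:R &
          ys k = (fun i => op A xc.1 i + \sum_l xc.2 l * e l i)].
      by move=> k; have [_ [x [c h]] _] := ysP k; exists (x, c).
    have xb k : lp (xc k).1 /\ nm (xc k).1 <= m%:R by have [] := xcP k.
    have [x [hx xm lim]] := nm_compact p1 xb.
    have cb l k : cabs ((xc k).2 l) <= m%:R by have [] := xcP k.
    have /choice[c clim] := fun l => tends_bounded (cb l).
    have ylim i : tends (fun k => ys k i) (y i).
      move=> d d0; have [N hN] := @lt_epsilon R 1 d ler01 d0.
      apply: (@ultra_nat_ge _ N) => k Nk /=; have [h1 _ h2] := ysP k.
      have [h3 _] := nmB p1 h1 hy.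
      rewrite (le_lt_trans (cabs_le_nm p1 i h3))// (le_lt_trans h2)//.
      by rewrite (le_lt_trans _ hN)// div1r lef_pV2 ?posrE// ler_nat.
    exists x, c; split=> // [l|].
      apply: (tends_cabs_le (clim l)); apply: filterE => k; exact: cb.
    apply/funext => i; apply: (tends_uniq (ylim i)).
    apply: (@tends_near _ _ (fun k => op A (xc k).1 i + \sum_l (xc k).2 l * e l i)).
      by apply: filterE => k /=; have [_ _ _ ->] := xcP k.
    apply: tendsD; first by apply: tends_op lim => j; exact: tends_cst.
    apply: tends_sum => l; apply: tendsM; [exact: clim|exact: tends_cst].
  - move=> m y z hy hz [x [c [h1 h2 h3 ->]]] [x' [c' [h1' h2' h3' ->]]].
    have [h5 h6] := nmB p1 h1 h1'; have [h7 h8] := nmZ p1 (real_complex R 2^-1) h5.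
    have half (u v : C) : cabs u <= m%:R -> cabs v <= m%:R ->
        cabs (real_complex R 2^-1 * (u - v)) <= m%:R.
      move=> um vm; rewrite normcM cabs_real ger0_norm ?invr_ge0//.
      by have := le_normcD u (- v); rewrite normcN; lra.
    exists (fun i => real_complex R 2^-1 * (x i - x' i)),
      (fun k => real_complex R 2^-1 * (c k - c' k)); split=> //.
    + rewrite (le_trans h8)// cabs_real ger0_norm ?invr_ge0//; lra.
    + by move=> k; exact: half.
    + rewrite opZ opB; apply/funext => i; set a := real_complex R 2^-1.
      have -> : \sum_k a * (c k - c' k) * e k i =
          a * (\sum_k c k * e k i) - a * (\sum_k c' k * e k i).
        by rewrite !mulr_sumr -sumrB; apply: eq_bigr => k _; ring.
      by ring.
  - move=> y hy; have [x [c [hx yE]]] := cover y hy.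
    pose t := nm x + \sum_k cabs (c k).
    have tc k : cabs (c k) <= t.
      rewrite /t (bigD1 k)//= addrCA lerDl addr_ge0 ?nm_ge0// sumr_ge0// => j _.
      exact: cabs_ge0.
    have tx : nm x <= t by rewrite lerDl sumr_ge0// => j _; exact: cabs_ge0.
    have tm : t <= (Num.truncn t).+1%:R := ltW (truncnS_gt _).
    exists (Num.truncn t).+1, x, c; split=> //.
    + exact: le_trans tx tm.
    + by move=> k; exact: le_trans (tc k) tm.
    + by rewrite yE; apply/funext => i; rewrite (matop_op MA).
exists n, e, m%:R, r; split=> // y hy yr.
by have [x [c [h1 h2 h3 h4]]] := ball y hy yr; exists x, c.
Qed.

(* Of n + 1 far apart copies of a right-hand side, some combination lies in the
   range of A, which leads to a solution on one of the windows. *)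
Lemma fredholm_onto : fredholm p (matop A) ->
  exists K, 0 <= K /\ forall y, lp y -> exists x, [/\ lp x, op A x = y & nm x <= K * nm y].
Proof.
have [MA _] := PA; move=> /fredholm_ball[n [e [M [r [r0 ball]]]]].
have M0 : 0 <= M.
  have [|x [c [_ h _]]] := ball _ (nm0 p1).1; first by rewrite (nm0 p1).2 ltW.
  by rewrite (le_trans _ h)// nm_ge0.
have n0 : 0 <= n.+1%:R * M by rewrite mulr_ge0.
exists (n.+1%:R * M / r); split; first by rewrite divr_ge0// ltW.
suff h y : lp y -> supp predT y -> nm y <= r -> exists x,
    [/\ lp x, supp predT x, op (sec predT A) x = y & nm x <= n.+1%:R * M].
  move=> y hy; have [x [h1 _ h2 h3]] := solve_scale p1 r0 h hy (@supp_predT R y).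
  by exists x.
move=> hy _ yr.
have local (L : nat) : exists k x, [/\ matches A A L L.+1%:R^-1 k, lp x, nm x <= n.+1%:R * M &
    forall i : int, `|i| <= L%:Z -> op (fun i j => A (i + k) (j + k)) x i = y i].
  have L0 : 0 < L.+1%:R^-1 :> R by rewrite invr_gt0.
  have [k0 hk] := PsiE_matches_disjoint L n.+1 PA MA L0.
  pose k (s : nat) : int := k0 + s%:Z * (2 * L%:Z + 1).
  pose ys (s : nat) (i : int) := if `|i - k s| <= L%:Z then y (i - k s) else 0.
  have ysP s : lp (ys s) /\ nm (ys s) <= r.
    have [h1 h2] := nm_shift p1 (- k s) hy.
    have [h3 h4] := nm_restrict p1 (fun i => `|i - k s| <= L%:Z) h1.
    by split=> //; rewrite (le_trans h4)// (le_trans h2).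
  have /choice[xc xcP] : forall s : nat, exists xc : (int -> C) * ('I_n -> C),
      [/\ lp xc.1, nm xc.1 <= M & ys s = (fun i => op A xc.1 i + \sum_k xc.2 k * e k i)].
    by move=> s; have [h1 h2] := ysP s; have [x [c h]] := ball _ h1 h2; exists (x, c).
  (* The relation cancels the part in the span of [e]. On the window of s0 the other copies vanish
     and the coefficient is 1, so X solves the equation exactly there. *)
  have [d [s0 [d0 d1 dc]]] := normalized_relation (fun s k => (xc s).2 k).
  pose X i := \sum_(s < n.+1) d s * (xc s).1 i.
  have [hX nX] : lp X /\ nm X <= n.+1%:R * M.
    have [|h1 h2] := nm_sum p1 (s := index_enum 'I_n.+1)
      (f := fun (s : 'I_n.+1) i => d s * (xc s).1 i) (c := fun=> M).
      move=> s _; have [h1 h2 _] := xcP s; have [h3 h4] := nmZ p1 (d s) h1.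
      split=> //; rewrite (le_trans h4)// -[M]mul1r ler_pM ?cabs_ge0 ?nm_ge0//.
    by split=> //; rewrite (le_trans h2)// sumr_const card_ord mulr_natl.
  have opX i : op A X i = \sum_(s < n.+1) d s * ys s i.
    rewrite /X op_sum.
    have -> : \sum_(s < n.+1) d s * ys s i = \sum_(s < n.+1) d s * op A (xc s).1 i +
        \sum_(s < n.+1) \sum_k d s * (xc s).2 k * e k i.
      rewrite -big_split/=; apply: eq_bigr => s _; have [_ _ ->] := xcP s.
      by rewrite mulrDr mulr_sumr; congr (_ + _); apply: eq_bigr => l _; rewrite mulrA.
    rewrite [X in _ = _ + X]exchange_big/= [X in _ = _ + X]big1 ?addr0// => l _.
    by rewrite -mulr_suml dc mul0r.
  have [h1 h2] := nm_shift p1 (k s0) hX.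
  exists (k s0), (fun i => X (i + k s0)); split=> //.
  - exact: hk.
  - exact: le_trans h2 nX.
  - move=> i iL; have := congr1 (@^~ i) (op_shift predT A (k s0) X).
    rewrite !sec_predT => ->; rewrite opX (bigD1 s0)//= d0 mul1r /ys addrK iL.
    rewrite big1 ?addr0// => s ss0; rewrite ifF ?mulr0//; apply/negbTE.
    have : (s : nat) != s0 by [].
    rewrite /k -ltNge; clear - iL; move: (s : nat) (s0 : nat) => u v uv.
    have [h|h] : u%:Z - v%:Z <= -1 \/ 1 <= u%:Z - v%:Z by lia.
      have : (u%:Z - v%:Z) * (2 * L%:Z + 1) <= -1 * (2 * L%:Z + 1).
        by rewrite ler_wpM2r//; lia.
      by rewrite mulrBl; lia.
    have : 1 * (2 * L%:Z + 1) <= (u%:Z - v%:Z) * (2 * L%:Z + 1).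
      by rewrite ler_wpM2r//; lia.
    by rewrite mulrBl; lia.
(* Seen from their windows, the solutions stay bounded and the shifted matrices tend to A entrywise,
   so a componentwise limit solves the original equation. *)
have /choice[kx kxP] : forall L : nat, exists kx : int * (int -> C),
    [/\ matches A A L L.+1%:R^-1 kx.1, lp kx.2, nm kx.2 <= n.+1%:R * M &
    forall i : int, `|i| <= L%:Z -> op (fun i j => A (i + kx.1) (j + kx.1)) kx.2 i = y i].
  by move=> L; have [k [x h]] := local L; exists (k, x).
have xb L : lp (kx L).2 /\ nm (kx L).2 <= n.+1%:R * M by have [] := kxP L.
have [x [hx xm lim]] := nm_compact p1 xb.
exists x; split=> //; apply/funext => i; rewrite sec_predT.
have Alim j : tends (fun L => A (i + (kx L).1) (j + (kx L).1)) (A i j).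
  move=> d d0; have [N hN] := @lt_epsilon R 1 d ler01 d0.
  apply: (@ultra_nat_ge _ (N + `|i|)%N) => L NL /=; have [h1 _ _ _] := kxP L.
  rewrite (lt_trans (h1 i j _))//; first by clear - NL; lia.
  by rewrite (le_lt_trans _ hN)// div1r lef_pV2 ?posrE// ler_nat ltnS; clear - NL; lia.
have h := tends_op (Bn := fun L i j => A (i + (kx L).1) (j + (kx L).1)) Alim lim.
apply: (tends_uniq h); apply: tends_near (tends_cst _).
apply: (@ultra_nat_ge _ `|i|%N) => L iL /=; have [_ _ _] := kxP L; apply.
by clear - iL; lia.
Qed.

(* Cut-off copies of a kernel vector on n + 1 far apart windows are corrected to
   n + 1 independent kernel vectors. *)
Lemma fredholm_inj : fredholm p (matop A) ->
  forall x, lp x -> op A x = (fun=> 0) -> x = (fun=> 0).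
Proof.
move=> fA; have [K [K0 solve]] := fredholm_onto fA; have [MA _] := PA.
have [_ [n [e ker]] _] := fA.
move=> x hx x0; apply/funext => i0; apply: contrapT => /eqP xi0.
have t0 : 0 < cabs (x i0) by rewrite lt_def cabs_eq0 xi0 cabs_ge0.
have b0 := le_trans (cabs_ge0 _) (Ab 0 0).
have nx0 := nm_ge0 p1 x.
(* For this L the n + 1 corrections below together stay smaller than |x i0|. *)
have [L hL] : exists L : nat, n.+1%:R * (K * (3 * (b + 1) * nm x)) / L.+1%:R < cabs (x i0).
  by apply: lt_epsilon => //; rewrite !mulr_ge0//; lra.
(* The window has to contain the support of the cut-off vector z, which is centred at i0, and its
   neighbours. *)
pose L1 : nat := (`|i0| + L + 1)%N.
have L0 : 0 < L.+1%:R^-1 :> R by rewrite invr_gt0.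
have [k0 hk] := PsiE_matches_disjoint L1 n.+1 PA MA L0.
pose k (s : nat) : int := k0 + s%:Z * (2 * L1%:Z + 1).
pose z i := real_complex R (hat R i0 L i) * x i.
have [hz nz] := nm_hat p1 i0 L hx.
have z0 (i : int) : L%:Z < `|i - i0| -> z i = 0.
  by move=> h; rewrite /z hat_out// rmorph0 mul0r.
have zi0 : z i0 = x i0 by rewrite /z hat_center rmorph1 mul1r.
(* The summand b accounts for the commutator with the tent, the summand 1 for the mismatch between A
   and its shifted copies. *)
pose eta : R := 3 * (b + 1) * nm x / L.+1%:R.
pose zs (s : nat) i := z (i - k s).
have zsP s : (s < n.+1)%N -> lp (op A (zs s)) /\ nm (op A (zs s)) <= eta.
  move=> sn.
  pose E (i j : int) := if `|i| <= L1%:Z then A (i + k s) (j + k s) - A i j else 0.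
  have Eb : bounded_by E L.+1%:R^-1.
    move=> i j; rewrite /E; case: ifPn => iL; last by rewrite normc0 ltW.
    exact/ltW/(hk s sn).
  have [h1 h2] := op_bounded p1 Eb hz; have [h3 _] := op_bounded p1 Ab hz.
  have h4 := op_hat p1 i0 L Ab hx.
  have [h5 h6] := nmD p1 h3 h1.
  have -> : op A (zs s) = (fun i => op A z (i - k s) + op E z (i - k s)).
    have sK : (fun i => zs s (i + k s)) = z by apply/funext => i; rewrite /zs addrK.
    have h := op_shift predT A (k s) (zs s); rewrite !sec_predT sK in h.
    apply/funext => i; have := congr1 (@^~ (i - k s)) h; rewrite /= subrK => <-.
    rewrite /op; set l := i - k s.
    have [lL|lL] := lerP `|l| L1%:Z.
      by rewrite /E lL; ring.
    by rewrite !z0 ?mulr0 ?addr0//; move: lL; rewrite /L1; clear; lia.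
  have [h7 h8] := nm_shift p1 (- k s) h5; split=> //.
  rewrite (le_trans h8)// (le_trans h6)//.
  have h9 : nm (op E z) <= 3 * L.+1%:R^-1 * nm x.
    by rewrite (le_trans h2)// ler_wpM2l// mulr_ge0// ltW.
  have -> : eta = 3 * (b / L.+1%:R) * nm x + 3 * L.+1%:R^-1 * nm x by rewrite /eta; ring.
  by rewrite lerD// (le_trans h4)// x0 (nm0 p1).2 add0r.
have lpzs s : lp (zs s) by exact: (nm_shift p1 (- k s) hz).1.
have /choice[tc tcP] : forall s : 'I_n.+1, exists tc : (int -> C) * ('I_n -> C),
    [/\ lp tc.1, nm tc.1 <= K * eta &
    forall i, zs s i - tc.1 i = \sum_(l < n) tc.2 l * e l i].
  move=> s; have [h1 h2] := zsP s (ltn_ord s); have [t [h3 h4 h5]] := solve _ h1.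
  have [h6 _] := nmB p1 (lpzs s) h3.
  have [|c hc] := ker _ h6.
    by rewrite (matop_op MA) opB h4; apply/funext => i; rewrite subrr.
  exists (t, c); split=> //; first by rewrite (le_trans h5)// ler_wpM2l.
  by move=> i; rewrite -(congr1 (@^~ i) hc).
(* The combined kernel vectors cancel. At i1 the copies contribute exactly x i0, so the corrections
   would have to add up to x i0, which their size forbids. *)
have [d [s0 [d0 d1 dc]]] := normalized_relation (fun s l => (tc s).2 l).
pose i1 := i0 + k s0.
have dz : \sum_(s < n.+1) d s * (zs s i1 - (tc s).1 i1) = 0.
  rewrite (eq_bigr (fun s : 'I_n.+1 => \sum_(l < n) d s * (tc s).2 l * e l i1)).
    by rewrite exchange_big/= big1// => l _; rewrite -mulr_suml dc mul0r.
  move=> s _; have [_ _ ->] := tcP s; rewrite mulr_sumr.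
  by apply: eq_bigr => l _; rewrite mulrA.
have dzs : \sum_(s < n.+1) d s * zs s i1 = x i0.
  rewrite (bigD1 s0)//= d0 mul1r /zs /i1 addrK zi0 big1 ?addr0// => s ss0.
  rewrite z0 ?mulr0//; have : (s : nat) != s0 by [].
  rewrite /k; clear; move: (s : nat) (s0 : nat) => u v uv.
  have [h|h] : u%:Z - v%:Z <= -1 \/ 1 <= u%:Z - v%:Z by lia.
    have : (u%:Z - v%:Z) * (2 * L1%:Z + 1) <= -1 * (2 * L1%:Z + 1).
      by rewrite ler_wpM2r//; lia.
    by rewrite mulrBl /L1; lia.
  have : 1 * (2 * L1%:Z + 1) <= (u%:Z - v%:Z) * (2 * L1%:Z + 1).
    by rewrite ler_wpM2r//; lia.
  by rewrite mulrBl /L1; lia.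
have : x i0 = \sum_(s < n.+1) d s * (tc s).1 i1.
  apply/eqP; rewrite -dzs -subr_eq0 -sumrB -[X in _ == X]dz; apply/eqP.
  by apply: eq_bigr => s _; rewrite mulrBr.
move=> /(congr1 (@normc R)) xE; move: hL; rewrite ltNge xE => /negP; apply.
rewrite (le_trans (cabs_sum _ _ _))//.
rewrite (le_trans (ler_sum _ (_ : forall s, true -> _ <= K * eta)))//.
  move=> s _; have [h1 h2 _] := tcP s; rewrite normcM -[leRHS]mul1r.
  by rewrite ler_pM ?cabs_ge0// (le_trans (cabs_le_nm p1 i1 h1)).
by rewrite sumr_const card_ord -[leLHS]mulr_natl /eta !mulrA.
Qed.

Lemma fredholm_inv_le : fredholm p (matop A) -> exists K, inv_le p predT A K.
Proof.
move=> fA; have [K [K0 solve]] := fredholm_onto fA; exists K; split=> //.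
  move=> x hx _; rewrite sec_predT.
  have [hy _] := op_bounded p1 Ab hx; have [z [hz zx zb]] := solve _ hy.
  have [h1 _] := nmB p1 hx hz.
  have h2 : (fun i => x i - z i) = (fun=> 0).
    apply: (fredholm_inj fA) => //; rewrite opB zx; apply/funext => i.
    by rewrite subrr.
  have xz : x = z.
    by apply/funext => i; apply/eqP; rewrite -subr_eq0 (congr1 (@^~ i) h2).
  by rewrite {1}xz.
by move=> y hy _; have [x [h1 h2 _]] := solve y hy; exists x.
Qed.

End Fredholm.

(** * The equivalences *)

Section Assembly.
Variables (R : realType) (p : \bar R).
Hypothesis p1 : (1 <= p)%E.
Local Notation C := (complex R).
Local Notation nm := (nm p).
Local Notation lp := (lp p).
Variables (U V W : set C).

Lemma compact_cabs (X : set C) : compact (X : set C^o) ->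
  exists r : R, 0 <= r /\ forall z, X z -> cabs z <= r.
Proof.
move=> cX.
have cts : continuous (fun z : C^o => cabs z : R^o).
  move=> x; have FF : Filter (nbhs (x : C^o)) by exact: nbhs_filter.
  apply: (proj2 (@cvgrPdist_lt R R^o _ (nbhs (x : C^o)) FF _ _)) => e e0.
  have e0' : 0 < real_complex R e by rewrite ltcR.
  have := nbhsx_ballx (x : C^o) _ e0'; apply: (@filterS _ _ FF) => y.
  rewrite /ball/= -[`|_|]/(real_complex R (cabs (x - y))) ltcR => h.
  exact: le_lt_trans (cabs_dist _ _) h.
have := continuous_compact (continuous_subspaceT cts) cX.
move=> /compact_bounded[M [_ hM]].
exists (Num.max 0 (M + 1)); split; first by rewrite le_max lexx.
move=> z Xz; rewrite le_max; apply/orP; right.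
have M1 : M < M + 1 by rewrite ltrDl.
have := hM (M + 1) M1 (cabs z) (ex_intro2 _ _ z Xz erefl).
by rewrite /= ger0_norm ?cabs_ge0.
Qed.

Variable b : R.
Hypotheses (b0 : 0 <= b) (bU : forall z, U z -> cabs z <= b)
  (bV : forall z, V z -> cabs z <= b) (bW : forall z, W z -> cabs z <= b).

Lemma Mbi_bounded B : Mbi U V W B -> bounded_by B b.
Proof.
move=> [BU BV BW B0] i j.
have [h|[h|[h|h]]] : i = j + 1 \/ i = j \/ j = i + 1 \/ 1 < `|i - j| by clear; lia.
- exact/bU/BU.
- by rewrite h; exact/bV/BV.
- exact/bW/BW.
- by rewrite B0// normc0.
Qed.
Local Notation Mb := Mbi_bounded.

Lemma invertible_fredholm A : Mbi U V W A -> invertible p (matop A) -> fredholm p (matop A).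
Proof.
move=> MA iA; have [K iK] := invertible_inv_le_int MA p1 iA; split.
- exact: (matop_bounded_int MA p1 (Mb MA)).
- exists 0%N, (fun _ => fun=> 0) => x hx; rewrite (matop_op MA) => x0.
  exists (fun=> 0); rewrite [x](inv_le_inj p1 iK hx (nm0 p1).1).
  + by apply/funext => i; rewrite big_ord0.
  + by [].
  + by [].
  + by rewrite sec_predT x0 op0.
- exists 0%N, (fun _ => fun=> 0); split=> [[]//|y hy].
  have [_ _ on] := iK; have [x [hx _ xy]] := on y hy (@supp_predT R y).
  exists x, (fun=> 0); split=> //; rewrite -xy; apply/funext => i.
  by rewrite (matop_op MA) big_ord0 addr0.
Qed.

Lemma inv_le_ext (S S' : pred int) B B' K : (forall i, S i = S' i) ->
  (forall i j, S i -> S j -> B i j = B' i j) -> inv_le p S B K -> inv_le p S' B' K.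
Proof.
move=> SS BB; have -> : S' = S by apply/funext => i; rewrite SS.
rewrite /inv_le /lower_bound /onto.
have -> : sec S B' = sec S B; last by [].
apply/funext => i; apply/funext => j; rewrite /sec; case: ifP => // /andP[Si Sj].
by rewrite BB.
Qed.

(** The section on a window of radius n is a shift by n of a square matrix of size 2 n + 1. *)
Lemma all_invertible_inv_le c u v w : U u -> V v -> W w ->
  all_invertible_le p U V W c -> forall B, Mbi U V W B ->
  inv_le p predT B c /\ forall n, inv_le p (window n) B c.
Proof.
move=> Uu Vv Ww [hbi _ hn] B MB; split.
  exact: (invertible_le_inv_le_int MB p1 (hbi B MB)).
move=> n; pose f (k : int) : 'I_(n + n).+1 := inord `|k|%N.
pose M : 'M[C]_((n + n).+1) := \matrix_(k, l) B (k%:Z - n%:Z) (l%:Z - n%:Z).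
pose S (k : int) := 0 <= k <= (n + n)%N%:Z.
pose pos (i : 'I_(n + n).+1) := Posz i.
have Spos i : S (pos i) by rewrite /S /pos; have := ltn_ord i; clear; lia.
have posK : cancel pos f by move=> i; rewrite /f /pos absz_nat inord_val.
have fK k : S k -> pos (f k) = k.
  by rewrite /S /pos /f => Sk; rewrite inordK; move: Sk; clear; lia.
have [BU BV BW B0] := MB.
have MM : Mn U V W M.
  split=> [i j ij|i|i j ij|i j ij]; rewrite mxE.
  - by apply: BU; move: ij => /=; clear; lia.
  - exact: BV.
  - by apply: BW; move: ij => /=; clear; lia.
  - by apply: B0; move: ij => /=; clear; lia.
have := invertible_le_inv_le Spos posK fK u v w MM p1 (hn _ M (ltn0Sn _) MM).
have Me := ext_mxP fK MM Uu Vv Ww.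
move=> /(inv_le_shift p1 n%:Z (Mb Me)); apply: inv_le_ext => [i|i j Si Sj].
  by rewrite /S /window; clear; lia.
by rewrite /ext_mx Si Sj mxE -/(pos _) -/(pos _) !fK// !addrK.
Qed.

(** Members of the three classes are compressions of members of M(U,V,W) to the integers, a half
    line or a finite interval, the missing entries being filled in by u, v and w. *)
Lemma all_invertible_le_of c u v w : U u -> V v -> W w ->
  (forall B (S : pred int), (forall i j k, S i -> S k -> i <= j -> j <= k -> S j) ->
     Mbi U V W B -> inv_le p S B c) ->
  all_invertible_le p U V W c.
Proof.
move=> Uu Vv Ww h; split=> [B MB|B MB|n B n0 MB].
- by apply: (inv_le_invertible_int MB p1 (Mb MB)); exact: h.
- have gK (k : int) : (0 <= k) -> Posz `|k|%N = k by clear; lia.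
  have Me := ext_mxP (g := absz) (S := fun k => 0 <= k) gK MB Uu Vv Ww.
  apply: (inv_le_invertible (pos := Posz) (g := absz) (S := fun k => 0 <= k)
    _ _ gK MB p1 (Mb Me)) => //.
  by apply: h => // i j k; clear; lia.
- case: n n0 B MB => // n _ B MB; pose f (k : int) : 'I_n.+1 := inord `|k|%N.
  pose S (k : int) := 0 <= k <= n%:Z; pose pos (i : 'I_n.+1) := Posz i.
  have Spos i : S (pos i) by rewrite /S /pos; have := ltn_ord i; clear; lia.
  have posK : cancel pos f by move=> i; rewrite /f /pos absz_nat inord_val.
  have fK k : S k -> pos (f k) = k.
    by rewrite /S /pos /f => Sk; rewrite inordK; move: Sk; clear; lia.
  have Me := ext_mxP fK MB Uu Vv Ww.
  apply: (inv_le_invertible Spos posK fK MB p1 (Mb Me)).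
  by apply: h => // i j k; rewrite /S; clear; lia.
Qed.

(** Deleting the entries that link S to its complement touches only off-diagonal entries, so 0 in U
    and W keeps the matrix in M(U,V,W); the compression becomes a direct summand. *)
Lemma inv_le_decouple K : U 0 -> W 0 ->
  (forall B, Mbi U V W B -> inv_le p predT B K) ->
  forall B (S : pred int), Mbi U V W B -> inv_le p S B K.
Proof.
move=> U0 W0 h B S MB; pose B' (i j : int) := if S i == S j then B i j else 0.
have MB' : Mbi U V W B'.
  have [BU BV BW B0] := MB; split=> [i j ij|i|i j ij|i j ij]; rewrite /B'.
  - by case: ifP => // _; exact: BU.
  - by rewrite eqxx.
  - by case: ifP => // _; exact: BW.
  - by case: ifP => // _; exact: B0.
have opE x : op (sec S B) (fun i => if S i then x i else 0) =
    (fun i => if S i then op B' x i else 0).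
  apply/funext => i; rewrite /op /sec /B'; case: (S i) => /=; last first.
    by rewrite !mul0r !addr0.
  by case: (S (i - 1)); case: (S (i + 1)); rewrite ?mul0r ?mulr0 ?addr0 ?add0r.
have suppE x : supp S x -> (fun i => if S i then x i else 0) = x.
  by move=> Sx; apply/funext => i; case: ifPn => // /Sx.
have opE' x : supp S x -> op B' x = op (sec S B) x.
  move=> Sx; apply/funext => i; have := congr1 (@^~ i) (opE x); rewrite suppE//= => ->.
  case: ifPn => // Si; rewrite /op /B' (negbTE Si) (Sx i Si) mulr0 addr0.
  have z j : (if false == S j then B i j else 0) * x j = 0.
    by have [Sj|/Sx ->] := boolP (S j); rewrite ?mul0r ?mulr0.
  by rewrite !z addr0.
have [K0 lb on] := h _ MB'; split=> // [x hx Sx|y hy Sy].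
  by have := lb x hx (@supp_predT R x); rewrite sec_predT opE'.
have [x [hx _ xy]] := on y hy (@supp_predT R y).
exists (fun i => if S i then x i else 0); split.
- exact: (nm_restrict p1 S hx).1.
- by move=> i /negbTE ->.
- by rewrite opE -[op B' x]/(op (sec predT B') x) xy suppE.
Qed.

Lemma inv_le_dominant (u v w : R) B (S : pred int) : 0 <= u -> 0 <= w -> u + w < v ->
  (forall z, U z -> cabs z <= u) -> (forall z, V z -> v <= cabs z) ->
  (forall z, W z -> cabs z <= w) -> Mbi U V W B ->
  inv_le p S B (v - (u + w))^-1.
Proof.
move=> u0 w0 uwv Uu Vv Ww MB; have [BU BV BW B0] := MB.
have d0 : 0 < v - (u + w) by lra.
have v0 : 0 < v by lra.
have lbS (T : pred int) : lower_bound p T B (v - (u + w))^-1.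
  move=> x hx Tx.
  (* Adding D to the compression leaves its diagonal, of modulus at least v on T, while the norm of
     D is at most u + w. *)
  pose D (i j : int) := if i == j then 0 else - sec T B i j.
  have Dle (t : R) (X : set C) i j : 0 <= t -> (forall z, X z -> cabs z <= t) ->
      X (B i j) -> cabs (D i j) <= t.
    move=> t0 Xt Xij; rewrite /D /sec; case: ifP => _; first by rewrite normc0.
    by rewrite normcN; case: ifP => _; rewrite ?normc0// Xt.
  have [h1 h2] : lp (op D x) /\ nm (op D x) <= (u + 0 + w) * nm x.
    apply: op_bound3 => // i.
    - by apply: (Dle _ U) => //; apply: BU => /=; rewrite subrK.
    - by rewrite /D eqxx normc0.
    - by apply: (Dle _ W) => //; exact: BW.
  have [h3 _] := op_bounded p1 (sec_bounded T (Mb MB)) hx.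
  have [h4 h5] := nmD p1 h3 h1.
  have vi0 : 0 <= v^-1 by rewrite invr_ge0 ltW.
  have [|_ h6] := nm_mono p1 (x := x) vi0 _ h4.
    move=> i; have [Ti|/Tx ->] := boolP (T i); last by rewrite normc0 mulr_ge0// cabs_ge0.
    have -> : op (sec T B) x i + op D x i = B i i * x i.
      rewrite /op /D eqxx !ifF; [|by apply/eqP; clear; lia|by apply/eqP; clear; lia].
      by rewrite {2}/sec Ti /=; ring.
    by rewrite normcM mulrA -[leLHS]mul1r ler_wpM2r ?cabs_ge0// ler_pdivlMl// mulr1 Vv.
  rewrite -ler_pdivrMl ?invr_gt0// invrK.
  have h7 : v * nm x <= nm (op (sec T B) x) + (u + w) * nm x.
    rewrite addr0 in h2; rewrite -ler_pdivlMl// (le_trans h6)// ler_wpM2l//.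
    by rewrite (le_trans h5)// lerD2l.
  by rewrite mulrBl lerBlDr.
have dinv : 0 <= (v - (u + w))^-1 by rewrite invr_ge0 ltW.
(* Finite truncations satisfy the same lower bound and are onto by dimension; S is their local
   limit. *)
apply: (inv_le_limit p1 (F := fun S B => inv_le p S B (v - (u + w))^-1) (Mb MB) dinv).
  move=> L e e0; exists (fun i => S i && (`|i| <= L%:Z)), B; split.
    by apply: (inv_le_fin p1 (L := L)) => // i /andP[].
  by move=> i j iL jL; rewrite iL andbT subrr normc0.
by [].
Qed.

End Assembly.

Unset Implicit Arguments.
Local Open Scope complex_scope.

Theorem theorem2p5 (R : realType) (U V W : set R[i]) (p : \bar R)
    (U0 : U !=set0) (V0 : V !=set0) (W0 : W !=set0)
    (cU : compact (U : set R[i]^o)) (cV : compact (V : set R[i]^o))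
    (cW : compact (W : set R[i]^o)) (p1 : (1 <= p)%E) :
  let delta : R := inf [set cabs v | v in V]
    - (sup [set cabs u | u in U] + sup [set cabs w | w in W]) in
  let s1 (A : int -> int -> R[i]) : Prop := fredholm p (matop A) in
  let s2 (A : int -> int -> R[i]) : Prop := invertible p (matop A) in
  let s3 (A : int -> int -> R[i]) : Prop := full_fsm_applicable p (matop A) in
  let s4 : Prop := exists c : R, all_invertible_le p U V W c in
  let s5 : Prop := forall B, Mbi U V W B -> full_fsm_applicable p (matop B) in
  let s6 : Prop := forall B, Mbi U V W B -> invertible p (matop B) in
  let s7 : Prop := forall B, Mbi U V W B -> fredholm p (matop B) in
  [/\ forall A, Mbi U V W A ->
        [/\ [/\ s4 -> s3 A, s3 A -> s2 A & s2 A -> s1 A],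
            [/\ s4 -> s5, s5 -> s6 & s6 -> s7]
          & [/\ s5 -> s3 A, s6 -> s2 A & s7 -> s1 A]],
      forall A, PsiE U V W A ->
        [<-> s1 A; s2 A; s6; s7] /\ (s3 A <-> s5),
      forall A, PsiE U V W A -> U 0 -> W 0 ->
        [<-> s1 A; s2 A; s3 A; s4; s5; s6; s7]
    & 0 < delta ->
        (forall A, Mbi U V W A ->
           [/\ s1 A, s2 A & s3 A] /\ [/\ s4, s5, s6 & s7]) /\
        all_invertible_le p U V W delta^-1].
Proof.
move=> delta s1 s2 s3 s4 s5 s6 s7.
have [u0 Uu0] := U0; have [v0 Vv0] := V0; have [w0 Ww0] := W0.
have [bU [bU0 hU]] := compact_cabs cU.
have [bV [bV0 hV]] := compact_cabs cV.
have [bW [bW0 hW]] := compact_cabs cW.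
pose b := bU + bV + bW.
have hU' z : U z -> cabs z <= b by move=> /hU; rewrite /b; lra.
have hV' z : V z -> cabs z <= b by move=> /hV; rewrite /b; lra.
have hW' z : W z -> cabs z <= b by move=> /hW; rewrite /b; lra.
have b0 : 0 <= b by rewrite /b; lra.
have Mb := Mbi_bounded b0 hU' hV' hW'.
have s43 B : s4 -> Mbi U V W B -> s3 B.
  move=> [c hc] MB.
  have [h1 h2] := all_invertible_inv_le p1 b0 hU' hV' hW' Uu0 Vv0 Ww0 hc MB.
  exact: (fsm_of_inv_le p1 MB (Mb _ MB) h1 (N := 0) (fun n _ => h2 n)).
have s32 B : s3 B -> s2 B by case.
have s21 B : Mbi U V W B -> s2 B -> s1 B.
  exact: (invertible_fredholm p1 b0 hU' hV' hW').
have inv_of c B : inv_le p predT B c -> Mbi U V W B -> s2 B.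
  by move=> iB MB; have [T ? _] := inv_le_invertible_int MB p1 (Mb _ MB) iB; exists T.
have s1K A : PsiE U V W A -> s1 A ->
    exists K, forall B, Mbi U V W B -> inv_le p predT B K.
  move=> PA fA; have [MA _] := PA.
  have [K iA] := fredholm_inv_le p1 PA (Mb _ MA) fA.
  by exists K => B; exact: (inv_le_PsiE p1 Mb PA iA).
have partA A : Mbi U V W A ->
    [/\ [/\ s4 -> s3 A, s3 A -> s2 A & s2 A -> s1 A],
        [/\ s4 -> s5, s5 -> s6 & s6 -> s7]
      & [/\ s5 -> s3 A, s6 -> s2 A & s7 -> s1 A]].
  move=> MA; split; split.
  - by move=> h4; exact: s43.
  - exact: s32.
  - exact: s21.
  - by move=> h4 B MB; exact: s43.
  - by move=> h5 B MB; exact/s32/h5.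
  - by move=> h6 B MB; exact/s21/h6.
  - exact.
  - exact.
  - exact.
split=> //.
- move=> A PA; have [MA _] := PA.
  have [[_ _ h21] [_ _ h67] [h53 _ h71]] := partA A MA.
  split; last by split=> // fA B MB; exact: (fsm_PsiE p1 Mb PA fA MB).
  (* The cycle (i), (ii), (vi), (vii), (i): its first two implications use the common bound from
     [s1K]. *)
  tfae=> // [/(s1K A PA)[K hK]|/h21/(s1K A PA)[K hK] B MB].
    exact: inv_of (hK A MA) MA.
  exact: inv_of (hK B MB) MB.
- move=> A PA U00 W00; have [MA _] := PA.
  have [[h43 h32 h21] [h45 h56 h67] [_ _ h71]] := partA A MA.
  (* This implication closes the cycle: decoupling makes all compressions, and with them the three
     classes, inherit the bound K. *)
  have h24 : s2 A -> s4.
    move=> /h21/(s1K A PA)[K hK]; exists K.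
    apply: (all_invertible_le_of p1 b0 hU' hV' hW' Uu0 Vv0 Ww0) => B S _ MB.
    exact: (inv_le_decouple p1 U00 W00 hK S MB).
  tfae=> //.
  + by move=> /(s1K A PA)[K hK]; exact: inv_of (hK A MA) MA.
  + by move=> /h24/h43.
  + by move=> /h32/h24.
- move=> d0.
  (* The bound r is required because [sup] is a meaningful supremum only for sets that are bounded
     above. *)
  have bound (X : set R[i]) (r : R) x : (forall z, X z -> cabs z <= r) -> X x ->
      0 <= sup [set cabs z | z in X] /\
      forall z, X z -> cabs z <= sup [set cabs z | z in X].
    move=> hX Xx; have ub z : X z -> cabs z <= sup [set cabs z | z in X].
      move=> Xz; apply: ub_le_sup; last by exists z.
      by exists r => _ [y Xy <-]; exact: hX.
    by split=> //; exact: le_trans (cabs_ge0 x) (ub x Xx).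
  have [u1 hu] := bound U bU u0 hU Uu0; have [w1 hw] := bound W bW w0 hW Ww0.
  have hv z : V z -> inf [set cabs z | z in V] <= cabs z.
    move=> Vz; apply: ge_inf; last by exists z.
    by exists 0 => _ [y _ <-]; exact: cabs_ge0.
  have all_d : all_invertible_le p U V W delta^-1.
    apply: (all_invertible_le_of p1 b0 hU' hV' hW' Uu0 Vv0 Ww0) => B S _ MB.
    by apply: (inv_le_dominant p1 b0 hU' hV' hW') => //; rewrite -subr_gt0.
  have h4 : s4 by exists delta^-1.
  split=> // A MA; have [[h43 h32 h21] [h45 h56 h67] _] := partA A MA.
  have h3 := h43 h4; have h5 := h45 h4.
  by split; split=> //; [apply/h21/h32|exact: h32|exact: h56|exact/h67/h56].
Qed.
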